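(* For $n\ge1$ and $k\ge0$ let $$\gamma^+_{n,k}(\mathbf{x},\mathbf{y})=\sum_{(\lambda,\mu)\vdash n}d^+_{(\lambda,\mu),k}\,s_\lambda(\mathbf{x})s_\mu(\mathbf{y}),\qquad \gamma^-_{n,k}(\mathbf{x},\mathbf{y})=\sum_{(\lambda,\mu)\vdash n}d^-_{(\lambda,\mu),k}\,s_\lambda(\mathbf{x})s_\mu(\mathbf{y}),$$ where $d^+_{(\lambda,\mu),k}$ (respectively, $d^-_{(\lambda,\mu),k}$) is the number of bitableaux $\mathcal{P}\in\mathrm{SYT}(\lambda,\mu)$ for which $\mathrm{Asc}_B(\mathcal{P})\in\mathrm{Stab}([n])$ has $k$ elements and does not contain (respectively, contains) $n$; let also $\gamma^+_{0,0}(\mathbf{x},\mathbf{y})=1$. Then $$\frac{E(\mathbf{x};z)E(\mathbf{x};tz)\left(E(\mathbf{y};tz)-tE(\mathbf{y};z)\right)}{E(\mathbf{x};tz)E(\mathbf{y};tz)-tE(\mathbf{x};z)E(\mathbf{y};z)}=\sum_{n\ge0}z^n\sum_{k=0}^{\lfloor n/2\rfloor}\gamma^+_{n,k}(\mathbf{x},\mathbf{y})\,t^k(1+t)^{n-2k}$$ and $$\frac{tE(\mathbf{x};z)E(\mathbf{x};tz)\left(E(\mathbf{y};z)-E(\mathbf{y};tz)\right)}{E(\mathbf{x};tz)E(\mathbf{y};tz)-tE(\mathbf{x};z)E(\mathbf{y};z)}=\sum_{n\ge1}z^n\sum_{k=1}^{\lfloor(n+1)/2\rfloor}\gamma^-_{n,k}(\mathbf{x},\mathbf{y})\,t^k(1+t)^{n+1-2k}.$$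 Moreover, for $n\ge1$, $$\gamma^{+}_{n,k}(\mathbf{x},\mathbf{y})=\sum_wF_{\mathrm{sDes}(w)}(\mathbf{x},\mathbf{y})\qquad\Big(\text{respectively, }\ \gamma^{-}_{n,k}(\mathbf{x},\mathbf{y})=\sum_wF_{\mathrm{sDes}(w)}(\mathbf{x},\mathbf{y})\Big),$$ where $w\in\mathcal{B}_n$ runs through all signed permutations for which $\mathrm{Asc}_B(w^{-1})\in\mathrm{Stab}([n])$ has $k$ elements and does not contain (respectively, contains) $n$.
   Context: Notation: $[m]=\{1,\dots,m\}$; $\mathrm{Stab}(\Theta)$ is the set of subsets of $\Theta\subseteq\mathbb{Z}$ containing no two consecutive integers. $\mathbf{x}=(x_1,x_2,\dots)$, $\mathbf{y}=(y_1,y_2,\dots)$; $E(\mathbf{x};z)=\sum_{n\ge0}e_n(\mathbf{x})z^n$ is the generating function of the elementary symmetric functions; $s_\lambda$ are Schur functions. The identities are between formal power series in $z$ whose coefficients are polynomials in $t$ over the ring of functions symmetric in $\mathbf{x}$ and in $\mathbf{y}$ separately. $\mathcal{B}_n$ is the hyperoctahedral group of signed permutations $w=(w(1),\dots,w(n))$ of $[n]$ (bijections $w$ of $\{\pm1,\dots,\pm n\}$ with $w(-i)=-w(i)$). A bipartition $(\lambda,\mu)\vdash n$ is a pair of integer partitions of total sum $n$. A standard Young bitableau of shape $(\lambda,\mu)\vdash n$ and size $n$ is a pair $\mathcal{P}=(\mathcal{P}^+,\mathcal{P}^-)$ of Young tableaux (entries increasing along rows and columns) of shapes $\lambda$ and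 $\mu$ such that every element of $[n]$ appears exactly once in $\mathcal{P}^+$ or $\mathcal{P}^-$; $\mathrm{SYT}(\lambda,\mu)$ is the set of these. For $w\in\mathcal{B}_n$ let $\varepsilon_i\in\{+,-\}$ be the sign of $w(i)$. $\mathrm{Des}(w)$ is the set of $i\in[n-1]$ with either $\varepsilon_i=+$, $\varepsilon_{i+1}=-$, or $\varepsilon_i=\varepsilon_{i+1}$ and $|w(i)|>|w(i+1)|$. $\mathrm{sDes}(w)=(\mathrm{Des}(w),\varepsilon)$ with $\varepsilon=(\varepsilon_1,\dots,\varepsilon_n)$. For a standard Young bitableau $\mathcal{P}$ of size $n$ let $\varepsilon_i$ be the sign of the part ($\mathcal{P}^+$ or $\mathcal{P}^-$) in which $i$ appears; $\mathrm{Des}(\mathcal{P})$ is the set of $i\in[n-1]$ with either $\varepsilon_i=+$, $\varepsilon_{i+1}=-$, or $\varepsilon_i=\varepsilon_{i+1}$ and $i+1$ appears in a lower row than $i$ (English notation). $\mathrm{Des}_B(\mathcal{P})=\mathrm{Des}(\mathcal{P})\cup\{n\}$ if $n$ appears in $\mathcal{P}^+$, and $\mathrm{Des}_B(\mathcal{P})=\mathrm{Des}(\mathcal{P})$ otherwise; $\mathrm{Asc}_B(\mathcal{P})=[n]\smallsetminus\mathrm{Des}_B(\mathcal{P})$. Similarly $\mathrm{Des}_B(w)=\mathrm{Des}(w)\cup\{n\}$ if $w(n)>0$, $\mathrm{Des}_B(w)=\mathrm{Des}(w)$ otherwise, and $\mathrm{Asc}_B(w)=[n]\smallsetminus\mathrm{Des}_B(w)$.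 For $w\in\mathcal{B}_n$ with $\mathrm{sDes}(w)=(\mathrm{Des}(w),\varepsilon)$, $$F_{\mathrm{sDes}(w)}(\mathbf{x},\mathbf{y})=\sum_{\substack{1\le i_1\le i_2\le\cdots\le i_n\\ j\in\mathrm{Des}(w)\Rightarrow i_j<i_{j+1}}}z_{i_1}z_{i_2}\cdots z_{i_n},$$ where $z_{i_j}=x_{i_j}$ if $\varepsilon_j=+$ and $z_{i_j}=y_{i_j}$ if $\varepsilon_j=-$. *)

(* Defs.v *)
From HB Require Import structures.
From mathcomp Require Import all_boot all_order all_algebra all_fingroup.
From mathcomp Require Import finmap.
From mathcomp Require Import all_classical.
From mathcomp Require Import monalg.

Set Implicit Arguments.
Unset Strict Implicit.
Unset Printing Implicit Defensive.

Import GRing.Theory.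
Local Open Scope classical_set_scope.
Local Open Scope ring_scope.

(** * Formal power series in an arbitrary set of variables *)

(* A series over [R] in the variables [J] is the family of its coefficients,
   indexed by the monomials [{cmonom J}] (the finitely supported exponents).
   Its product is the convolution below, not the pointwise product which
   [mathcomp.classical] puts on function types. *)
Definition mseries (J : choiceType) (R : Type) := {cmonom J} -> R.

Section MSeriesDef.
Context {J : choiceType} {R : comNzRingType}.
Implicit Types (f g h : mseries J R) (m : {cmonom J}).

Definition factors m : set ({cmonom J} * {cmonom J}) :=
  [set p | mmul p.1 p.2 = m].

Definition mser_one : mseries J R := fun m => (m == mone)%:R.

Definition mser_mul f g : mseries J R :=
  fun m => \sum_(p \in factors m) f p.1 * g p.2.

Definition mser_scale (a : R) f : mseries J R := fun m => a * f m.

Definition mser_var (j : J) : mseries J R := fun m => (m == ucm j)%:R.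

HB.instance Definition _ :=
  GRing.Zmodule.copy (mseries J R) ({cmonom J} -> R).

Lemma mmulIm m : injective (mmul m).
Proof.
move=> a b /eqP/cmP e; apply/eqP/cmP => i.
by have /eqP := e i; rewrite !cmM eqn_add2l => /eqP.
Qed.

Lemma finite_factors m : finite_set (factors m).
Proof.
pose N := (mdeg m).+1; pose G := {ffun finsupp m -> 'I_N}.
pose h (u : G * G) : {cmonom J} * {cmonom J} :=
  (mkcmonom [fsfun i : finsupp m => nat_of_ord (u.1 i) | 0%N],
   mkcmonom [fsfun i : finsupp m => nat_of_ord (u.2 i) | 0%N]).
apply: (@sub_finite_set _ _ (h @` [set: G * G])); last first.
  by apply: finite_image; exact: finite_finset.
have ltN i : (m i < N)%N.
  rewrite ltnS; case: mdomP => // im.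
  by rewrite mdegE (big_fsetD1 i) //= leq_addr.
have small (a b : {cmonom J}) i : mmul a b = m -> (a i < N)%N.
  move=> e; apply: leq_ltn_trans (ltN i).
  by rewrite -e cmM leq_addr.
have mk (a b : {cmonom J}) : mmul a b = m ->
    mkcmonom [fsfun i : finsupp m => nat_of_ord (inord (a (val i)) : 'I_N)
             | 0%N] = a.
  move=> e; apply/eqP/cmP => i; rewrite cmE fsfun_ffun.
  case: insubP => [u _ ui /=|].
    by rewrite inordK ?ui// (small a b).
  move=> im; have : mmul a b i == 0%N by rewrite e cmE_eq0.
  by rewrite cmM addn_eq0 => /andP[/eqP -> _].
move=> [a b] /= e.
exists ([ffun i => inord (a (val i))], [ffun i => inord (b (val i))]) => //.
rewrite /h /=; congr (_, _).
  rewrite -[RHS](mk a b) //; congr (mkcmonom _).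
  by apply/fsfunP => i; rewrite !fsfun_ffun; case: insubP => //= u _ _; rewrite ffunE.
have e' : mmul b a = m by rewrite mulmC.
rewrite -[RHS](mk b a) //; congr (mkcmonom _).
by apply/fsfunP => i; rewrite !fsfun_ffun; case: insubP => //= u _ _; rewrite ffunE.
Qed.

Lemma mser_mulC : commutative mser_mul.
Proof.
move=> f g; apply/funext => m; rewrite /mser_mul.
rewrite (reindex_fsbig (fun p => (p.2, p.1)) (factors m)) //=.
  by apply: eq_fsbigr => p _; rewrite mulrC.
split.
- by move=> [a b]; rewrite /factors /= mulmC.
- by move=> [a b] [c d] _ _ [-> ->].
- by move=> [a b]; rewrite /factors /= => e; exists (b, a); rewrite //= mulmC.
Qed.

Lemma mser_mul1 : left_id mser_one mser_mul.
Proof.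
move=> f; apply/funext => m; rewrite /mser_mul /mser_one.
rewrite (fsbigD1 (mone, m)) /=; first last.
- by rewrite /factors /= mul1m.
- exact: sub_finite_set (finite_factors m).
rewrite eqxx mul1r fsbig1 ?addr0 // => -[a b] /= [e ne].
case: eqP => [a1|]; last by rewrite mul0r.
by case: ne; move: e; rewrite /factors /= a1 mul1m => ->.
Qed.

Lemma mser_mulDl : left_distributive mser_mul +%R.
Proof.
move=> f g h; apply/funext => m.
transitivity (mser_mul f h m + mser_mul g h m); last by [].
rewrite /mser_mul.
rewrite !fsbig_finite; try exact: finite_factors.
rewrite -big_split; apply: eq_bigr => p _; exact: mulrDl.
Qed.

(* Convolution over any finite set of monomials closed under divisors. *)
Lemma mser_mulE f g (D : {fset {cmonom J}}) m :
    (forall a b, mmul a b \in D -> a \in D /\ b \in D) -> m \in D ->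
  mser_mul f g m =
    \sum_(a <- D) \sum_(b <- D) (f a * g b) *+ (mmul a b == m).
Proof.
move=> clD mD.
have -> : mser_mul f g m =
    \sum_(p \in [set` D] `*` [set` D]) (f p.1 * g p.2) *+ (mmul p.1 p.2 == m).
  rewrite /mser_mul fsbig_mkcond [RHS]fsbig_mkcond.
  apply: eq_fsbigr => p _; rewrite /patch /=.
  case: (eqVneq (mmul p.1 p.2) m) => [e|ne]; last first.
    rewrite memNset ?if_same //.
    by move=> /eqP; rewrite (negbTE ne).
  have [p1 p2] : p.1 \in D /\ p.2 \in D by apply: clD; rewrite e.
  by rewrite !mem_set.
rewrite -(@pair_fsbig _ 0 +%R _ _ [set` D] [set` D] (fun a b => (f a * g b) *+ (mmul a b == m))) //.
rewrite fsbig_finite ?finite_fset // set_fsetK.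
by apply: eq_bigr => a _; rewrite fsbig_finite ?finite_fset // set_fsetK.
Qed.

Lemma mser_mulA : associative mser_mul.
Proof.
move=> f g h; apply/funext => m.
have fin : finite_set (fst @` factors m) by exact/finite_image/finite_factors.
pose D := fset_set (fst @` factors m).
have inD a : (a \in D) <-> exists b, mmul a b = m.
  rewrite /D in_fset_set // inE; split=> [[[u v] /= e <-]|[b e]].
    by exists v.
  by exists (a, b).
have clD a b : mmul a b \in D -> a \in D /\ b \in D.
  move=> /inD[c e]; split; apply/inD.
    by exists (mmul b c); rewrite mulmA.
  by exists (mmul a c); rewrite mulmA (mulmC b).
have mD : m \in D by apply/inD; exists mone; rewrite mulm1.
have delta (c : {cmonom J}) (F : {cmonom J} -> R) :
    (c \in D) -> \sum_(b <- D) F b *+ (c == b) = F c.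
  move=> cD; rewrite (big_fsetD1 c) //= eqxx big1_fset ?addr0 // => b.
  by rewrite in_fsetD1 eq_sym => /andP[/negbTE ->].
have out (c u : {cmonom J}) : c \notin D -> (mmul u c == m) = false.
  move=> cD; apply/negbTE; apply: contra cD => /eqP e.
  by apply/inD; exists u; rewrite mulmC.
have delta' (c u : {cmonom J}) (x : R) :
    \sum_(b <- D) (x *+ (mmul u b == m)) *+ (c == b) = x *+ (mmul u c == m).
  case: (boolP (c \in D)) => cD; first by rewrite (delta c (fun b => x *+ _)).
  rewrite out // mulr0n big1_fset // => b bD _.
  by have [e|_] := eqVneq c b; rewrite ?mulr0n //; move: cD; rewrite e bD.
transitivity (\sum_(a <- D) \sum_(c <- D) \sum_(d <- D)
    (f a * g c * h d) *+ (mmul a (mmul c d) == m)).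
  rewrite (mser_mulE _ _ clD) //; apply: eq_bigr => a _.
  under eq_big_seq => b bD.
    rewrite (mser_mulE _ _ clD) // mulr_sumr -sumrMnl.
    under eq_bigr do rewrite mulr_sumr -sumrMnl.
    over.
  rewrite exchange_big /=; apply: eq_bigr => c _.
  rewrite exchange_big /=; apply: eq_bigr => d _.
  rewrite -delta'; apply: eq_bigr => b _.
  by rewrite mulrnAr mulrA -!mulrnA mulnC.
symmetry; rewrite (mser_mulE _ _ clD) //.
under eq_big_seq => b bD.
  under eq_bigr => d _.
    rewrite (mser_mulE _ _ clD) // mulr_suml -sumrMnl.
    under eq_bigr do rewrite mulr_suml -sumrMnl.
    over.
  over.
under eq_bigr do rewrite exchange_big /=.
rewrite exchange_big /=; apply: eq_bigr => a _.
under eq_bigr do rewrite exchange_big /=.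
rewrite exchange_big /=; apply: eq_bigr => c _.
rewrite exchange_big /=; apply: eq_bigr => d _.
rewrite mulmA [mmul (mmul a c) d]mulmC -delta'; apply: eq_bigr => b _.
by rewrite mulrnAl -!mulrnA mulnC [mmul d b]mulmC.
Qed.

Lemma mser_one_neq0 : mser_one != 0 :> mseries J R.
Proof.
apply/eqP => /(congr1 (fun f : mseries J R => f mone)).
by rewrite /mser_one eqxx => /eqP; rewrite oner_eq0.
Qed.

HB.instance Definition _ := GRing.Zmodule_isComNzRing.Build (mseries J R)
  mser_mulA mser_mulC mser_mul1 mser_mulDl mser_one_neq0.

Fact mser_scaleA a b f : mser_scale a (mser_scale b f) = mser_scale (a * b) f.
Proof. by apply/funext => m; rewrite /mser_scale mulrA. Qed.

Fact mser_scale1 : left_id 1 mser_scale.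
Proof. by move=> f; apply/funext => m; rewrite /mser_scale mul1r. Qed.

Fact mser_scaleDr : right_distributive mser_scale +%R.
Proof. by move=> a f g; apply/funext => m; exact: mulrDr. Qed.

Fact mser_scaleDl f : {morph mser_scale^~ f : a b / a + b}.
Proof. by move=> a b; apply/funext => m; exact: mulrDl. Qed.

HB.instance Definition _ := GRing.Zmodule_isLmodule.Build R (mseries J R)
  mser_scaleA mser_scale1 mser_scaleDr mser_scaleDl.

Fact mser_scaleAl a f g : a *: (f * g) = a *: f * g.
Proof.
apply/funext => m.
rewrite [LHS]fsbig_distrr; last exact: finite_factors.
by apply: eq_fsbigr => p _; exact: mulrA.
Qed.

HB.instance Definition _ :=
  GRing.Lmodule_isLalgebra.Build R (mseries J R) mser_scaleAl.

(* The formal sum of the series [u i], [i \in A], computed coefficient by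
   coefficient. It is meaningful when every monomial occurs in only finitely
   many of the [u i], which holds in all the uses below. *)
Definition formal_sum (I : choiceType) (A : set I) (u : I -> mseries J R) :
    mseries J R :=
  fun m => \sum_(i \in A) u i m.

End MSeriesDef.

(* [N / D = q] in the total ring of fractions: [D] is not a zero divisor and
   [q] is the quotient. *)
Definition is_quotient (R : comNzRingType) (N D q : R) : Prop :=
  GRing.lreg D /\ D * q = N.

(** * Symmetric functions *)

(* Power series in [x_1, x_2, ...] (the variables [inl 0], [inl 1], ...) and
   [y_1, y_2, ...] (the variables [inr 0], [inr 1], ...). This ring contains
   both the functions symmetric in [x] and in [y] and the quasisymmetric
   functions [F_sDes w]. *)
Notation xyser := (mseries (nat + nat)%type int).

Definition xvar (i : nat) : xyser := mser_var (inl i).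
Definition yvar (i : nat) : xyser := mser_var (inr i).

(* The functions below take the alphabet, [xvar] or [yvar], as [v]. *)
Definition elemsym (v : nat -> xyser) (n : nat) : xyser :=
  formal_sum [set A : {fset nat} | #|` A| = n] (fun A => \prod_(i <- A) v i).

Definition is_partition (la : seq nat) : bool :=
  sorted geq la && (0%N \notin la).

Definition is_bipartition (n : nat) (p : seq nat * seq nat) : bool :=
  [&& is_partition p.1, is_partition p.2 & (sumn p.1 + sumn p.2 == n)%N].

(* A tableau is the list of its rows, from top to bottom; [ltr] orders the
   entries along the rows. *)
Definition is_tableau (ltr : rel nat) (la : seq nat) (T : seq (seq nat)) :
    Prop :=
  [/\ map size T = la, all (sorted ltr) T &
      forall r c, (c < size (nth [::] T r.+1))%N ->
        (nth 0%N (nth [::] T r) c < nth 0%N (nth [::] T r.+1) c)%N].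

Definition schur (v : nat -> xyser) (la : seq nat) : xyser :=
  formal_sum [set T | is_tableau leq la T] (fun T => \prod_(i <- flatten T) v i).

(** * Signed descents *)

(* Throughout, [i : 'I_n] stands for the element [i + 1] of [[n]], and [true]
   for the sign [+]. *)
Section SignedDescents.
Variables (n : nat) (eps : 'I_n -> bool) (D : rel 'I_n).

(* [D i j] is the descent condition between consecutive letters [i] and [j]
   of the same sign. *)
Definition sdes : {set 'I_n} :=
  [set i : 'I_n | [exists j : 'I_n, (j == i.+1 :> nat) &&
     ((eps i && ~~ eps j) || ((eps i == eps j) && D i j))]].

Definition sdesB : {set 'I_n} :=
  (sdes :|: [set i : 'I_n | (i.+1 == n) && eps i])%SET.

Definition sascB : {set 'I_n} := (~: sdesB)%SET.

End SignedDescents.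

Definition in_Stab (n : nat) (A : {set 'I_n}) : bool :=
  [forall i in A, forall j in A, j != i.+1 :> nat].

Definition has_max (n : nat) (A : {set 'I_n}) : bool :=
  [exists i in A, i.+1 == n].

(* [A] is in [Stab([n])], has [k] elements, and contains [n] iff [b]. *)
Definition Stab_card (b : bool) (n k : nat) (A : {set 'I_n}) : bool :=
  [&& in_Stab A, #|A| == k & has_max A == b].

(** * Standard Young bitableaux *)

Definition bitableau := (seq (seq nat) * seq (seq nat))%type.

(* In accordance with the indexing of [[n]] by ['I_n], the entries are
   [0, ..., n - 1]. *)
Definition is_SYT2 (n : nat) (p : seq nat * seq nat) (P : bitableau) : Prop :=
  [/\ is_tableau ltn p.1 P.1, is_tableau ltn p.2 P.2 &
      perm_eq (flatten P.1 ++ flatten P.2) (iota 0 n)].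

Definition sign_tab (P : bitableau) (i : nat) : bool := i \in flatten P.1.

Definition row_of (P : bitableau) (i : nat) : nat :=
  find (fun r : seq nat => i \in r) (if sign_tab P i then P.1 else P.2).

Definition AscB_tab (n : nat) (P : bitableau) : {set 'I_n} :=
  sascB (fun i : 'I_n => sign_tab P i)
        (fun i j : 'I_n => (row_of P i < row_of P j)%N).

(* [d^-] for [b = true] and [d^+] for [b = false]; the set is finite. *)
Definition dcoef (b : bool) (n : nat) (p : seq nat * seq nat) (k : nat) : nat :=
  #|` fset_set [set P | is_SYT2 n p P /\ Stab_card b k (AscB_tab n P)]|.

Definition gamma (b : bool) (n k : nat) : xyser :=
  \sum_(p \in [set p | is_bipartition n p])
     (schur xvar p.1 * schur yvar p.2) *+ dcoef b n p k.

Definition gamma_plus (n k : nat) : xyser :=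
  if n is 0 then (k == 0%N)%:R else gamma false n k.

Definition gamma_minus (n k : nat) : xyser := gamma true n k.

(** * Signed permutations *)

(* [(i, true)] and [(i, false)] stand for [i + 1] and [- (i + 1)]. *)
Definition sletter (n : nat) := ('I_n * bool)%type.

Definition sopp (n : nat) (a : sletter n) : sletter n := (a.1, ~~ a.2).

Definition hyperoct (n : nat) : {set {perm sletter n}} :=
  [set w : {perm sletter n} | [forall a, w (sopp a) == sopp (w a)]].

Definition sign_perm (n : nat) (w : {perm sletter n}) (i : 'I_n) : bool :=
  (w (i, true)).2.

Definition abs_perm (n : nat) (w : {perm sletter n}) (i : 'I_n) : 'I_n :=
  (w (i, true)).1.

Definition Des_perm (n : nat) (w : {perm sletter n}) : {set 'I_n} :=
  sdes (sign_perm w) (fun i j : 'I_n => (abs_perm w j < abs_perm w i)%N).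

Definition AscB_perm (n : nat) (w : {perm sletter n}) : {set 'I_n} :=
  sascB (sign_perm w) (fun i j : 'I_n => (abs_perm w j < abs_perm w i)%N).

Definition quasisym (n : nat) (Des : {set 'I_n}) (eps : 'I_n -> bool) : xyser :=
  formal_sum
    [set i : {ffun 'I_n -> nat} | forall j l : 'I_n, l = j.+1 :> nat ->
       (i j <= i l)%N /\ (j \in Des -> (i j < i l)%N)]
    (fun i => \prod_(j < n) (if eps j then xvar (i j) else yvar (i j))).

Definition F_sDes (n : nat) (w : {perm sletter n}) : xyser :=
  quasisym (Des_perm w) (sign_perm w).

(** * Generating functions *)

(* Power series in [z] whose coefficients are polynomials in [t]. *)
Notation tpoly := {poly xyser}.
Notation zser := (mseries unit tpoly).

Definition tvar : tpoly := 'X.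
Definition zvar : zser := mser_var tt.

(* [E(v; u)], to be used for [u = z] and [u = tz]. *)
Definition Egen (v : nat -> xyser) (u : zser) : zser :=
  formal_sum [set: nat] (fun n => (elemsym v n)%:P *: u ^+ n).

(* Main.v *)
Require Import Defs.
From mathcomp Require Import all_boot all_order all_algebra all_fingroup.
From mathcomp Require Import finmap.
From mathcomp Require Import all_classical.
From mathcomp Require Import monalg.
From mathcomp Require Import zify ring.

Set Implicit Arguments.
Unset Strict Implicit.
Unset Printing Implicit Defensive.

Import GRing.Theory.
Local Open Scope classical_set_scope.
Local Open Scope ring_scope.

(* Encode a pair (w, i) of a signed permutation and an index sequence
   compatible with sDes(w) by the word u whose letter in position p is the
   [i_j]-th variable of the alphabet given by the sign of w(j), where
   |w(j)| = p. Then w is recovered by sorting the positions of u, and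
   Asc_B(w^-1) is read off the ascents of u. So the sum of F_sDes(w) over a
   class of inverse ascent sets is the generating series of a class of signed
   words. Robinson-Schensted insertion, applied to the positive and to the
   negative letters separately, turns it into the sum over bitableaux.

   For the generating functions, let W_c be the series of the words with
   ascent pattern c (a bit per letter), T(c) the weight t^k (1+t)^(...) of a
   stable pattern, and t U(c) = T(1c) the weight of a tail that follows an
   ascent. An induction on c gives, for {kap, s} = {1, t},
     T = kap E(x; sz) E(y; sz) U + const * E(x; sz),
   with T and U now denoting the series sum_c T(c) W_c and sum_c U(c) W_c.
   Eliminating U between the two equations gives the two quotients. *)

(** * Generating series of weighted families *)

Section Monomials.
Context {J : choiceType} {R : comNzRingType}.
Implicit Types (u v : seq J) (m : {cmonom J}).

(** The weights obey [T(0c) = (1+t) T(c)], [T(1c) = t U(c)], [U(0c) = T(c)] and [U(1c) = 0]. The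
    induction on [c] uses only [kap + s = 1 + t] and [kap * s = t], so the roots 1 and t may be
    taken in either order; this gives two equations for the same [T] and [U].

    The product [E(x; sz) E(y; sz)] is the series of ascent-free words: positive letters strictly
    decreasing, then negative letters strictly decreasing. Multiplying by it puts such a word in
    front of another one; the ascent bit at the junction is not controlled by either factor, so it
    has to stay free in the recursion.

    The last bit of a pattern says whether the last letter is negative. A pattern that is zero
    everywhere, last bit included, therefore forces all letters to be positive, which is why the
    remaining term involves [E(x; sz)] alone. *)

Definition mon m : mseries J R := fun m' => (m' == m)%:R.

Definition wt u : {cmonom J} := \big[mmul/mone]_(j <- u) ucm j.

Lemma wt_nil : wt [::] = mone. Proof. exact: big_nil. Qed.

Lemma wt_cons j u : wt (j :: u) = mmul (ucm j) (wt u).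
Proof. exact: big_cons. Qed.

Lemma wt_cat u v : wt (u ++ v) = mmul (wt u) (wt v).
Proof. exact: big_cat. Qed.

Lemma perm_wt u v : perm_eq u v -> wt u = wt v.
Proof. exact: perm_big. Qed.

Lemma finite_seqs (T : choiceType) (A : set T) n : finite_set A ->
  finite_set [set s : seq T | size s = n /\ forall x, x \in s -> A x].
Proof.
move=> fA; elim: n => [|n IH].
  by apply: (@sub_finite_set _ _ [set [::]]) => // s /= [/size0nil].
apply: (@sub_finite_set _ _ ((fun p => p.1 :: p.2) @`
   (A `*` [set s : seq T | size s = n /\ forall x, x \in s -> A x]))).
  move=> [[] //|x s /= [[szs] h]]; exists (x, s) => //; split=> /=.
    by apply: h; rewrite inE eqxx.
  by split=> // y ys; apply: h; rewrite inE ys orbT.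
exact/finite_image/finite_setX.
Qed.

Lemma size_wt u : mdeg (wt u) = size u.
Proof.
elim: u => [|j u IH]; first by rewrite wt_nil mdeg1.
by rewrite wt_cons mdegM mdegU IH.
Qed.

Lemma mem_wt u j : j \in u -> j \in finsupp (wt u).
Proof.
elim: u => //= k u IH; rewrite inE wt_cons mdomD inE mdomU inE.
by case/orP => [->//|/IH ->]; rewrite orbT.
Qed.

Lemma finite_wt m : finite_set [set u | wt u = m].
Proof.
apply: sub_finite_set (finite_seqs (mdeg m) (finite_fset (finsupp m))).
move=> u /= <-; rewrite size_wt; split=> // j; exact: mem_wt.
Qed.

Lemma mon1 : mon mone = 1. Proof. by []. Qed.

Lemma monM m1 m2 : mon m1 * mon m2 = mon (mmul m1 m2).
Proof.
apply/funext => m; rewrite [LHS]/(mser_mul _ _ _) /mser_mul /mon.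
case: (eqVneq m (mmul m1 m2)) => [->|ne].
  rewrite (fsbigD1 (m1, m2)) //=; last exact: finite_factors.
  rewrite !eqxx mulr1 fsbig1 ?addr0 // => -[a b] /= [_ ne].
  case: eqP => [ea|]; rewrite ?mul0r //; case: eqP => [eb|]; rewrite ?mulr0 //.
  by case: ne; rewrite ea eb.
rewrite fsbig1 // => -[a b] /= e.
case: eqP => [ea|]; rewrite ?mul0r //; case: eqP => [eb|]; rewrite ?mulr0 //.
by move: ne; rewrite -e /= ea eb eqxx.
Qed.

Lemma prod_mser_var u : \prod_(j <- u) mser_var j = mon (wt u).
Proof.
elim: u => [|j u IH]; first by rewrite big_nil wt_nil.
by rewrite big_cons IH wt_cons -monM.
Qed.

Lemma mser_sumE (I : Type) (r : seq I) (P : pred I) (F : I -> mseries J R) m :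
  (\sum_(i <- r | P i) F i) m = \sum_(i <- r | P i) F i m.
Proof. by elim/big_ind2: _ => // f a g b <- <-. Qed.

Lemma eq_mser_mul (f f' g g' : mseries J R) m :
    (forall a b, mmul a b = m -> f a = f' a /\ g b = g' b) ->
  (f * g) m = (f' * g') m.
Proof.
move=> h; apply: eq_fsbigr => -[a b]; rewrite inE /factors /= => e.
by have [-> ->] := h a b e.
Qed.

End Monomials.

Section GenSeries.
Context {J : choiceType} {R : comNzRingType}.

(* Meaningful only when [f] takes each weight finitely often on [A]. *)
Definition gser (I : choiceType) (A : set I) (f : I -> seq J) : mseries J R :=
  formal_sum A (fun i => mon (wt (f i))).

Definition finfib (I : Type) (A : set I) (f : I -> seq J) :=
  forall m, finite_set [set i | A i /\ wt (f i) = m].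

(** Only finitely many words have a given weight, so injectivity of the word map bounds each
    fibre. *)
Lemma finfib_inj (I : choiceType) (A : set I) f : set_inj A f -> finfib A f.
Proof.
move=> fi m.
have fin : finite_set (f @` [set i | A i /\ wt (f i) = m]).
  by apply: sub_finite_set (finite_wt m) => _ [i [_ e] <-].
have ij : set_inj [set i | A i /\ wt (f i) = m] f.
  by move=> i j /set_mem[iA _] /set_mem[jA _]; apply: fi; rewrite inE.
by rewrite -(eq_finite_set (inj_card_eq ij)).
Qed.

(** Trades an infinite formal sum, one coefficient at a time, for a finite sum in the ring of
    series, where the lemmas on big operators apply. *)
Lemma gser_coef (I : choiceType) (A : set I) f (F : {fset I}) m :
    [set` F] `<=` A -> [set i | A i /\ wt (f i) = m] `<=` [set` F] ->
  gser A f m = (\sum_(i <- F) mon (wt (f i))) m.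
Proof.
move=> FA AF; rewrite mser_sumE /gser /formal_sum (fsbigE F) //.
  rewrite big_seq_cond [RHS]big_seq_cond; apply: eq_bigl => i.
  by case: (boolP (i \in F)) => //= /FA iF; rewrite mem_set.
move=> i iA iF; rewrite /mon; case: eqP => // e.
by have := AF i (conj iA (esym e)); rewrite /= (negbTE iF).
Qed.

Lemma eq_gser_bij (I I' : choiceType) (A : set I) (B : set I') f g
    (h : I -> I') : set_bij A B h -> (forall i, A i -> wt (g (h i)) = wt (f i)) ->
  gser A f = gser B g.
Proof.
move=> hb e; apply/funext => m; rewrite /gser /formal_sum.
rewrite (reindex_fsbig h A B (fun i => mon (wt (g i)) m) hb).
by apply: eq_fsbigr => i; rewrite inE => iA; rewrite e.
Qed.

Lemma eq_gser (I : choiceType) (A B : set I) f g : A = B ->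
  (forall i, A i -> wt (f i) = wt (g i)) -> gser A f = gser B g.
Proof.
move=> <- e; apply/funext => m; apply: eq_fsbigr => i; rewrite inE => iA.
by rewrite e.
Qed.

Lemma gser_set1 (I : choiceType) (i : I) f : gser [set i] f = mon (wt (f i)).
Proof. by apply/funext => m; rewrite /gser /formal_sum fsbig_set1. Qed.

Lemma finfibX (I I' : choiceType) (A : set I) (B : set I') f g :
  finfib A f -> finfib B g -> finfib (A `*` B) (fun p => f p.1 ++ g p.2).
Proof.
move=> fA fB m; pose D := factors m.
apply: (@sub_finite_set _ _ (\bigcup_(p in D)
  ([set i | A i /\ wt (f i) = p.1] `*` [set i | B i /\ wt (g i) = p.2]))).
  by move=> [i j] [[/= iA jB]]; rewrite wt_cat => e; exists (wt (f i), wt (g j)).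
by apply: bigcup_finite => [|p _]; [exact: finite_factors|exact: finite_setX].
Qed.

(** The coefficient at [m] involves only indices whose weight divides [m]; there are finitely many,
    so both factors are truncated to them. *)
Lemma gserM (I I' : choiceType) (A : set I) (B : set I') f g :
    finfib A f -> finfib B g ->
  gser A f * gser B g = gser (A `*` B) (fun p => f p.1 ++ g p.2).
Proof.
move=> fA fB; apply/funext => m; have fX := finfibX fA fB m.
pose a (m1 : {cmonom J}) := [set i | A i /\ wt (f i) = m1].
pose b (m1 : {cmonom J}) := [set i | B i /\ wt (g i) = m1].
have finA : finite_set (\bigcup_(p in factors m) a p.1).
  by apply: bigcup_finite => [|p _]; [exact: finite_factors|exact: fA].
have finB : finite_set (\bigcup_(p in factors m) b p.2).
  by apply: bigcup_finite => [|p _]; [exact: finite_factors|exact: fB].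
pose FA := fset_set (\bigcup_(p in factors m) a p.1).
pose FB := fset_set (\bigcup_(p in factors m) b p.2).
have sFA : [set` FA] `<=` A.
  by rewrite /FA fset_setK // => i [p _ []].
have sFB : [set` FB] `<=` B.
  by rewrite /FB fset_setK // => i [p _ []].
rewrite (@eq_mser_mul _ _ _ (\sum_(i <- FA) mon (wt (f i))) _
   (\sum_(i <- FB) mon (wt (g i)))); last first.
  move=> m1 m2 e; split; apply: gser_coef => // i /= [iA ei].
    by rewrite /FA in_fset_set // inE; exists (m1, m2).
  by rewrite /FB in_fset_set // inE; exists (m1, m2).
rewrite (@gser_coef _ _ _ (FA `*` FB)%fset) //; first last.
- move=> [i j] /= [[iA jB]]; rewrite wt_cat => e; rewrite inE /=.
  by rewrite /FA /FB !in_fset_set //; apply/andP; split; apply/mem_set;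
    exists (wt (f i), wt (g j)).
- by move=> [i j] /=; rewrite inE => /andP[/= iA jB]; split; [exact: sFA|exact: sFB].
congr ((_ : mseries J R) m).
rewrite mulr_suml.
under eq_bigr do rewrite mulr_sumr.
rewrite /fsetM big_imfset2 /=; last by move=> [? ?] [? ?] _ _ /= [-> ->].
by apply: eq_bigr => i _; apply: eq_bigr => j _; rewrite wt_cat monM.
Qed.

Lemma gser_partition (I K : choiceType) (A : set I) f (h : I -> K) (C : seq K) :
    finfib A f -> uniq C -> (forall i, A i -> h i \in C) ->
  gser A f = \sum_(c <- C) gser (A `&` [set i | h i = c]) f.
Proof.
move=> fA uC hC; apply/funext => m; rewrite mser_sumE.
have fm := fA m; pose F := fset_set [set i | A i /\ wt (f i) = m].
have inF i : i \in F -> A i /\ wt (f i) = m by rewrite /F in_fset_set // inE.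
have Fin i : A i -> wt (f i) = m -> i \in F.
  by rewrite /F in_fset_set // inE.
rewrite (@gser_coef _ _ _ F) //; first last.
- by move=> i /= [iA e]; apply: Fin.
- by move=> i /= /inF[].
rewrite mser_sumE.
under [RHS]eq_bigr => c _.
  rewrite (@gser_coef _ _ _ [fset i in F | h i == c]%fset).
  - rewrite mser_sumE big_fset /= big_mkcond.
    over.
  - by move=> i /=; rewrite !inE => /andP[/inF[iA _] /eqP].
  - by move=> i /= [[iA e] em]; rewrite !inE e eqxx andbT; exact: Fin.
rewrite exchange_big /= big_seq [RHS]big_seq; apply: eq_bigr => i iF.
rewrite (bigD1_seq (h i)) //=; last by apply: hC; have [] := inF _ iF.
by rewrite eqxx big1 ?addr0 // => c; rewrite eq_sym => /negbTE ->.
Qed.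

(** Replaces a multiplicity by an extra index; in [gamma_words] that index is the recording
    bitableau. *)
Lemma gser_mulrn (I K : choiceType) (A : set I) f (S : set K) :
    finfib A f -> finite_set S ->
  gser A f *+ #|` fset_set S| = gser (A `*` S) (fun p => f p.1).
Proof.
move=> fA fS.
have fAS : finfib (A `*` S) (fun p => f p.1).
  move=> m; apply: sub_finite_set (finite_setX (fA m) fS).
  by move=> [i s] /= [[iA sS] e].
rewrite (@gser_partition _ _ _ _ snd (fset_set S)) //; last first.
  by move=> [i s] /= [_ sS]; rewrite in_fset_set // inE.
rewrite big_seq (eq_bigr (fun=> gser A f)) -?big_seq.
  by rewrite big_const_seq count_predT iter_addr_0.
move=> s; rewrite in_fset_set // inE => sS.
apply: (@eq_gser_bij _ _ _ _ _ _ fst) => //; split.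
- by move=> [i s'] /= [[]].
- by move=> [i s1] [j s2] /set_mem[_ /= ->] /set_mem[_ /= ->] /= ->.
- by move=> i iA; exists (i, s).
Qed.

End GenSeries.

(** * Row insertion *)

Section RowInsertion.
Local Open Scope nat_scope.
Implicit Types (r s : seq nat) (T : seq (seq nat)) (x y i j : nat).

Definition below r s : bool :=
  (size s <= size r) && all (fun c => nth 0 r c < nth 0 s c) (iota 0 (size s)).

(** Recursive counterpart of [is_tableau], suited to induction on rows. Empty rows are excluded so
    that equal tableaux cannot differ by trailing empty rows. *)
Fixpoint tableau (ltr : rel nat) T : bool :=
  if T is r :: T' then
    [&& sorted ltr r, r != [::], below r (head [::] T') & tableau ltr T']
  else true.

Lemma belowP r s : reflect
  (size s <= size r /\ forall c, c < size s -> nth 0 r c < nth 0 s c)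
  (below r s).
Proof.
apply: (iffP andP) => -[h1 h2]; split=> //.
  by move=> c cs; apply: (allP h2); rewrite mem_iota.
by apply/allP => c; rewrite mem_iota => /h2.
Qed.

Lemma sorted_leqP r : reflect
  (forall i j, i <= j -> j < size r -> nth 0 r i <= nth 0 r j) (sorted leq r).
Proof.
apply: (iffP idP) => [h i j ij jr|h].
  by apply: (sorted_leq_nth leq_trans leqnn) => //; rewrite inE //; lia.
apply/(sortedP 0) => i hi; exact: h.
Qed.

(** Entries equal to [x] are not bumped, since rows increase weakly; the value [size r] means that
    [x] is appended. *)
Definition inspos r x := find (ltn x) r.

Lemma insposP r x : sorted leq r ->
  [/\ inspos r x <= size r,
      forall c, c < inspos r x -> nth 0 r c <= x &
      forall c, inspos r x <= c -> c < size r -> x < nth 0 r c].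
Proof.
move=> /sorted_leqP sr; split=> [|c hc|c hc cr]; first exact: find_size.
  by rewrite leqNgt; have /= -> := before_find 0 hc.
apply: leq_trans (sr _ _ hc cr); apply: (@nth_find _ 0 (ltn x)).
rewrite has_find; exact: leq_ltn_trans hc cr.
Qed.

Lemma find_uniq (p : pred nat) r j : j <= size r ->
  (forall c, c < j -> ~~ p (nth 0 r c)) -> (j < size r -> p (nth 0 r j)) ->
  find p r = j.
Proof.
move=> jr lo hi; rewrite -[r](cat_take_drop j) find_cat size_take_min.
rewrite (minn_idPl jr) ifN; last first.
  apply/negP => /(hasP) [y /(nthP 0)[c]].
  rewrite size_take_min (minn_idPl jr) => cj.
  by rewrite nth_take // => <- /=; rewrite (negbTE (lo _ cj)).
case: (ltnP j (size r)) => [jlt|jge].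
  by rewrite (drop_nth 0) //= hi // addn0.
by rewrite drop_oversize // addn0.
Qed.

Lemma inspos_uniq r x j : j <= size r ->
  (forall c, c < j -> nth 0 r c <= x) -> (j < size r -> x < nth 0 r j) ->
  inspos r x = j.
Proof.
by move=> jr lo hi; apply: find_uniq => // c cj; rewrite -leqNgt lo.
Qed.

Fixpoint ins T x : seq (seq nat) :=
  if T is r :: T' then
    let j := inspos r x in
    set_nth 0 r j x :: (if j < size r then ins T' (nth 0 r j) else T')
  else [:: [:: x]].

(** The row where the bumping route ends, hence the row of the new cell. *)
Fixpoint insrow T x : nat :=
  if T is r :: T' then
    let j := inspos r x in
    if j < size r then (insrow T' (nth 0 r j)).+1 else 0
  else 0.

Lemma size_set_nth_le r j x : j <= size r ->
  size (set_nth 0 r j x) = (if j < size r then size r else (size r).+1).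
Proof. by rewrite size_set_nth; case: ltnP; lia. Qed.

Lemma shape_ins T x :
  map size (ins T x) = incr_nth (map size T) (insrow T x).
Proof.
elim: T x => [|r T IH] x //=.
have jr : inspos r x <= size r by exact: find_size.
by case: ifP => h /=; rewrite size_set_nth_le // h // IH.
Qed.

Lemma perm_set_nth r j x : j < size r ->
  perm_eq (nth 0 r j :: set_nth 0 r j x) (x :: r).
Proof.
move=> jr; apply/seq.permP => p; rewrite set_nthE jr.
rewrite -[in RHS](cat_take_drop j r) (drop_nth 0 jr) /= !count_cat /=; lia.
Qed.

Lemma perm_ins T x : perm_eq (flatten (ins T x)) (x :: flatten T).
Proof.
elim: T x => [|r T IH] x //=.
have jr : inspos r x <= size r by exact: find_size.
case: ifP => h.
  have /seq.permP p1 := IH (nth 0 r (inspos r x)).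
  have /seq.permP p2 := perm_set_nth x h.
  apply/seq.permP => p; have := p1 p; have := p2 p.
  rewrite /= !count_cat; lia.
have -> : inspos r x = size r by lia.
rewrite set_nthE ltnn subnn /=; apply/seq.permP => p.
by rewrite /= !count_cat /=; lia.
Qed.

Lemma sorted_set_inspos r x : sorted leq r ->
  sorted leq (set_nth 0 r (inspos r x) x).
Proof.
move=> sr; have [jr lo hi] := insposP x sr; move/sorted_leqP: sr => sr.
apply/sorted_leqP => a b ab; rewrite size_set_nth_le // !nth_set_nth /=.
move=> hb; case: (a =P _) => [ea|na]; case: (b =P _) => [eb|nb] //.
- by apply/ltnW/hi; first lia; move: hb; case: ifP; lia.
- by apply: lo; lia.
- by apply: sr => //; move: hb; case: ifP; lia.
Qed.

Lemma head_ins T x :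
  head [::] (ins T x) =
    set_nth 0 (head [::] T) (inspos (head [::] T) x) x.
Proof. by case: T. Qed.

Lemma tableau_sorted_head ltr T : tableau ltr T -> sorted ltr (head [::] T).
Proof. by case: T => //= r T /and4P[]. Qed.

Lemma tableau_ins T x : tableau leq T -> tableau leq (ins T x).
Proof.
elim: T x => [|r T IH] x //= /and4P[sr nr /belowP[szr dr] tT].
have [jr lo hi] := insposP x sr.
set j := inspos r x in jr lo hi *.
have ne : set_nth 0 r j x != [::].
  by rewrite -size_eq0 size_set_nth; lia.
rewrite sorted_set_inspos // ne /=.
case: ifP => [jlt|jge]; last first.
  rewrite tT andbT; apply/belowP; rewrite size_set_nth_le // jge; split; first lia.
  move=> c cs; rewrite nth_set_nth /= ifN ?dr //.
  by apply/eqP; lia.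
rewrite IH // andbT head_ins; set y := nth 0 r j; set s := head [::] T in szr dr *.
have ss : sorted leq s by exact: tableau_sorted_head tT.
have [ks lo' hi'] := insposP y ss; set k := inspos s y in ks lo' hi' *.
(* The bumping route moves weakly left: an entry of [s] in column [j] lies below [y], so it exceeds
   [y] and stops the search. *)
have kj : k <= j.
  rewrite leqNgt; apply/negP => jk.
  have := lo' _ jk; have := dr j; rewrite -/y; lia.
have xy : x < y by apply: hi.
apply/belowP; rewrite !size_set_nth_le // jlt; split; first by case: ifP; lia.
move=> c hc; rewrite !nth_set_nth /=.
case: (eqVneq c k) => [->|nck].
  case: eqP => // nkj; apply: leq_ltn_trans xy; apply: lo; lia.
have cs : c < size s by move: hc; case: ifP; lia.
case: eqP => [ecj|_]; last exact: dr.
by apply: ltn_trans xy _; rewrite /y -ecj dr.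
Qed.

(** The row bumping lemma. If [y < x], the second route stays weakly left of the first and carries a
    smaller entry into each row, so it ends strictly lower; if [x <= y], it stays strictly right and
    ends no lower. *)
Lemma insrow_lt T x y : tableau leq T ->
  (insrow T x < insrow (ins T x) y) = (y < x).
Proof.
elim: T x y => [|r T IH] x y /=.
  by rewrite /inspos /=; case: (y < x).
move=> /and4P[sr _ _ tT].
have [jr lo hi] := insposP x sr; have sr' := sorted_set_inspos x sr.
set j := inspos r x in jr lo hi sr' *; set r' := set_nth 0 r j x in sr' *.
have [kr lo' hi'] := insposP y sr'; set k := inspos r' y in kr lo' hi' *.
have sz : size r' = if j < size r then size r else (size r).+1.
  by rewrite size_set_nth_le.
have nj : nth 0 r' j = x by rewrite nth_set_nth /= eqxx.
have jr' : j < size r' by rewrite sz; case: ifP; lia.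
case: (ltnP y x) => [yx|xy].
  have kj : k <= j.
    by rewrite leqNgt; apply/negP => jk; have := lo' _ jk; rewrite nj; lia.
  rewrite (leq_ltn_trans kj jr').
  case: ifP => [jlt|//]; rewrite ltnS IH //.
  case: (eqVneq k j) => [->|nkj]; first by rewrite nj hi.
  rewrite /r' nth_set_nth /= (negbTE nkj).
  apply: leq_ltn_trans (hi _ (leqnn _) jlt); apply: lo; lia.
have jk : j < k.
  rewrite ltnNge; apply/negP => kj.
  by have := hi' _ kj jr'; rewrite nj; lia.
case: ifP => [jlt|jge].
  case: ifP => [klt|//]; rewrite ltnS IH // ltnNge.
  move: klt; rewrite sz jlt => klt.
  rewrite /r' nth_set_nth /= ifN; last by apply/eqP; lia.
  by move/sorted_leqP: sr => ->; rewrite // ltnW.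
by rewrite ifN // sz jge -leqNgt; lia.
Qed.

(* The inverse of row insertion, started at the last cell of row [i]. *)
Fixpoint unins T i : nat * seq (seq nat) :=
  if T is r :: T' then
    if i is i'.+1 then
      let p := unins T' i' in
      let j := (find (leq p.1) r).-1 in
      (nth 0 r j, set_nth 0 r j p.1 :: p.2)
    else (last 0 r,
          if size r == 1 then T' else take (size r).-1 r :: T')
  else (0, [::]).

Lemma set_nth_id r j : j < size r -> set_nth 0 r j (nth 0 r j) = r.
Proof.
move=> jr; apply: (@eq_from_nth _ 0) => [|c _]; first by rewrite size_set_nth; lia.
by rewrite nth_set_nth /=; case: eqP => // ->.
Qed.

Lemma insK T x : tableau leq T -> unins (ins T x) (insrow T x) = (x, T).
Proof.
elim: T x => [|r T IH] x //= /and4P[sr nr _ tT].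
have [jr lo hi] := insposP x sr; set j := inspos r x in jr lo hi *.
case: ifP => [jlt|jge].
  rewrite IH //=; have xy := hi _ (leqnn _) jlt.
  (* After the bump, the first entry at least as large as the bumped one is in column [j.+1]; this
     is why [unins] takes a predecessor. *)
  have -> : find (leq (nth 0 r j)) (set_nth 0 r j x) = j.+1.
    have sz : size (set_nth 0 r j x) = size r by rewrite size_set_nth_le ?jlt.
    apply: find_uniq; rewrite ?sz //; [move=> c|move=> jlt'].
      rewrite ltnS nth_set_nth /= => cj.
      case: eqP => [_|ncj]; first by rewrite -ltnNge.
      by rewrite -ltnNge (leq_ltn_trans (lo _ _) xy) //; lia.
    rewrite nth_set_nth /= ifN; last by apply/eqP; lia.
    by move/sorted_leqP: sr => -> //; lia.
  rewrite /= nth_set_nth /= eqxx; congr (_, _ :: _).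
  by rewrite set_set_nth eqxx set_nth_id.
have -> : j = size r by lia.
have -> : set_nth 0 r (size r) x = rcons r x.
  by rewrite set_nthE ltnn subnn /= cats1.
rewrite last_rcons size_rcons /= eqSS size_eq0 (negbTE nr).
by rewrite -cats1 take_size_cat.
Qed.

Lemma uninsP T i (x := (unins T i).1) (T1 := (unins T i).2) :
    tableau leq T -> i < size T ->
    size (nth [::] T i.+1) < size (nth [::] T i) ->
  [/\ tableau leq T1, ins T1 x = T & insrow T1 x = i].
Proof.
move=> tT iT cT.
(* Putting a row back on top needs more than the claim: [x] comes from a column [j] of the first
   row, that row does not get longer, its surviving entries do not decrease, and from column [j] on
   they exceed [x]. *)
suff [] : [/\ tableau leq T1, ins T1 x = T, insrow T1 x = i,
   size (head [::] T1) <= size (head [::] T) &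
   exists2 j, j < size (head [::] T) /\ x = nth 0 (head [::] T) j &
     forall c, c < size (head [::] T1) ->
       nth 0 (head [::] T) c <= nth 0 (head [::] T1) c /\
       (j <= c -> x < nth 0 (head [::] T1) c)] by [].
rewrite {}/x {}/T1; elim: T i tT iT cT => // r T IH [|i] /=.
  move=> /and4P[sr nr dr tT] _; rewrite nth0 => szT.
  case: (eqVneq (size r) 1) => [r1|nr1].
    case: T tT dr szT {IH} => [|s T] /=; last first.
      by move=> /and4P[_ ns _ _] _; rewrite r1 ltnS leqn0 size_eq0 (negbTE ns).
    case: r sr nr r1 => // a [] //= _ _ _.
    by split=> //; exists 0.
  have r0 : 0 < size r by move: nr; rewrite -size_eq0; lia.
  have sz : size (take (size r).-1 r) = (size r).-1.
    by rewrite size_take_min (minn_idPl _) //; lia.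
  have er : rcons (take (size r).-1 r) (last 0 r) = r.
    rewrite -nth_last -take_nth; last lia.
    by rewrite prednK // take_size.
  have se : inspos (take (size r).-1 r) (last 0 r) = size (take (size r).-1 r).
    apply: inspos_uniq; rewrite // ?ltnn // sz => c hc.
    rewrite nth_take // -nth_last; move/sorted_leqP: sr; apply; lia.
  split=> /=.
  - apply/and4P; split=> //; first exact: take_sorted.
      by rewrite -size_eq0 sz; lia.
    move/belowP: dr => [s1 s2]; apply/belowP; rewrite sz; split; first lia.
    by move=> c hc; rewrite nth_take ?s2 //; lia.
  - by rewrite se ltnn set_nthE ltnn subnn /= cats1 er.
  - by rewrite se ltnn.
  - by rewrite sz; lia.
  exists (size r).-1; first by rewrite -nth_last; split=> //; lia.
  by move=> c; rewrite sz => hc; rewrite nth_take //; split=> //; lia.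
move=> /and4P[sr nr /belowP[dr1 dr2] tT]; rewrite ltnS => iT szT.
have [t1 e1 e2 s1 [k [k1 k2] k3]] := IH _ tT iT szT.
set p := unins T i in t1 e1 e2 s1 k2 k3 *; set T1 := p.2 in t1 e1 e2 s1 k3 *.
set y := p.1 in e1 e2 k2 k3 *.
(* The entry of [r] just above the old place of [y] is smaller than [y], so [r] has an entry that
   [y] can push out upwards. *)
have [f1 f2 f3] : [/\ 0 < find (leq y) r, find (leq y) r <= size r &
    forall c, c < find (leq y) r -> nth 0 r c < y].
  have f3 c : c < find (leq y) r -> nth 0 r c < y.
    by move=> hc; rewrite ltnNge; have /= -> := before_find 0 hc.
  split=> //; last exact: find_size.
  rewrite lt0n; apply/negP => /eqP f0.
  have h : y <= nth 0 r 0.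
    rewrite -[X in nth _ _ X]f0; apply: (@nth_find _ 0 (leq y)).
    by rewrite has_find f0; lia.
  have := dr2 _ k1; rewrite -k2.
  by move/sorted_leqP: sr => /(_ 0 k isT); lia.
have f4 c : find (leq y) r <= c -> c < size r -> y <= nth 0 r c.
  move=> hc cr; move/sorted_leqP: (sr) => h; apply: leq_trans (h _ _ hc cr).
  apply: (@nth_find _ 0 (leq y)); rewrite has_find; exact: leq_ltn_trans hc cr.
set j := (find (leq y) r).-1.
have jr : j < size r by rewrite /j; lia.
have ry : nth 0 r j < y by apply: f3; rewrite /j; lia.
have f4' c : j < c -> c < size r -> y <= nth 0 r c.
  by move=> hc; apply: f4; rewrite /j in hc; lia.
have f3' c : c <= j -> nth 0 r c < y.
  by move=> hc; apply: f3; rewrite /j in hc; lia.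
have sz : size (set_nth 0 r j y) = size r by rewrite size_set_nth_le ?jr // ltnW.
have pe : inspos (set_nth 0 r j y) (nth 0 r j) = j.
  apply: inspos_uniq; rewrite ?sz; first exact: ltnW.
    move=> c cj; rewrite nth_set_nth /= ifN; last by apply/eqP; lia.
    by move/sorted_leqP: sr; apply; lia.
  by rewrite nth_set_nth /= eqxx.
have kj : k <= j.
  rewrite leqNgt; apply/negP => jk.
  have := f4' _ jk; have := dr2 _ k1; rewrite -k2; lia.
split=> /=.
- apply/and4P; split=> //.
  + apply/sorted_leqP => a b ab; rewrite sz !nth_set_nth /= => br.
    case: eqP => ea; case: eqP => eb //.
    * by apply: f4' => //; lia.
    * by apply/ltnW/f3'; lia.
    * by move/sorted_leqP: sr; apply.
  + by rewrite -size_eq0 sz size_eq0.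
  + apply/belowP; rewrite sz; split; first lia.
    move=> c hc; rewrite nth_set_nth /=; have [c1 c2] := k3 _ hc.
    case: eqP => [ecj|_]; first by apply: c2; lia.
    by apply: leq_trans c1; apply: dr2; lia.
- by rewrite pe sz jr set_set_nth eqxx nth_set_nth /= eqxx e1 set_nth_id.
- by rewrite pe sz jr nth_set_nth /= eqxx e2.
- by rewrite sz.
exists j => // c; rewrite sz => hc; rewrite nth_set_nth /=.
case: eqP => [->|ne]; first by rewrite ltnW.
by split=> // jc; apply: leq_trans ry _; apply: f4' => //; lia.
Qed.

End RowInsertion.

(** * Adding a cell to a tableau *)

Section AddCell.
Local Open Scope nat_scope.
Implicit Types (r : seq nat) (T Q : seq (seq nat)) (n m i : nat).

Lemma tableau_size_le ltr T i : tableau ltr T ->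
  size (nth [::] T i.+1) <= size (nth [::] T i).
Proof.
elim: T i => [|r T IH] [|i] //= /and4P[_ _ /belowP[h _] tT]; last exact: IH.
by rewrite nth0.
Qed.

(** The default [[::]] of [nth] also makes the first empty row below a nonempty tableau addable. *)
Definition addable T i : bool :=
  (i == 0) || (size (nth [::] T i) < size (nth [::] T i.-1)).

Fixpoint addcell T i n : seq (seq nat) :=
  match T, i with
  | [::], _ => [:: [:: n]]
  | r :: T', 0 => rcons r n :: T'
  | r :: T', i'.+1 => r :: addcell T' i' n
  end.

Lemma addable_cons r T i : addable (r :: T) i.+1 ->
  addable T i /\ (i = 0 -> size (head [::] T) < size r).
Proof.
by rewrite /addable; case: i => [|i] /=; rewrite ?nth0 => h; split.
Qed.

Lemma addable_nil i : addable [::] i -> i = 0.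
Proof. by rewrite /addable !nth_nil ltnn orbF => /eqP. Qed.

Lemma shape_addcell T i n : addable T i ->
  map size (addcell T i n) = incr_nth (map size T) i.
Proof.
elim: T i => [|r T IH] [|i] //= => [/addable_nil //||].
  by rewrite size_rcons.
by move=> /addable_cons[/IH -> _].
Qed.

Lemma perm_addcell T i n :
  perm_eq (flatten (addcell T i n)) (n :: flatten T).
Proof.
elim: T i => [|r T IH] [|i] //=.
  by apply/seq.permP => p; rewrite /= !count_cat -cats1 count_cat /=; lia.
have /seq.permP h := IH i; apply/seq.permP => p; have := h p.
by rewrite /= !count_cat; lia.
Qed.

Lemma head_addcell T i n :
  head [::] (addcell T i n) =
    if i == 0 then rcons (head [::] T) n
    else if T is r :: _ then r else [:: n].
Proof. by case: T i => [|r T] [|i]. Qed.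

Lemma sorted_rcons_max r n : sorted ltn r -> all (ltn^~ n) r ->
  sorted ltn (rcons r n).
Proof.
case: r => //= a r; rewrite rcons_path => -> /andP[an /allP rn] /=.
by have := mem_last a r; rewrite inE => /orP[/eqP ->|/rn].
Qed.

Lemma tableau_addcell T i n : tableau ltn T -> all (ltn^~ n) (flatten T) ->
  addable T i -> tableau ltn (addcell T i n).
Proof.
elim: T i => [|r T IH] i //= /and4P[sr nr /belowP[b1 b2] tT].
rewrite all_cat => /andP[rn Tn]; case: i => [|i] /=.
  move=> _; apply/and4P; split=> //.
  - exact: sorted_rcons_max.
  - by case: (r).
  - apply/belowP; rewrite size_rcons; split; first lia.
    by move=> c hc; rewrite nth_rcons (leq_trans hc b1) b2.
move=> /addable_cons[aT a0]; rewrite sr nr IH // andbT /=.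
apply/belowP; rewrite head_addcell; case: eqP => [i0|_].
  have {}a0 := a0 i0; rewrite size_rcons; split=> // c hc.
  rewrite nth_rcons; case: ifP => [hc'|hc']; first exact: b2.
  have -> : c = size (head [::] T) by lia.
  by rewrite eqxx; apply/(allP rn)/mem_nth.
case: T {IH aT a0 Tn tT} b1 b2 => //= _ _; split; first by case: (r) nr.
by case=> // _ /=; apply: (allP rn); apply: mem_nth; case: (r) nr.
Qed.

Lemma find_row_addcell T i n : addable T i -> n \notin flatten T ->
  find (fun r => n \in r) (addcell T i n) = i.
Proof.
elim: T i => [|r T IH] [|i] //=; rewrite ?mem_cat ?negb_or.
- by rewrite inE eqxx.
- by move=> /addable_nil.
- by rewrite mem_rcons inE eqxx.
- by move=> /addable_cons[/IH h _] /andP[/negbTE -> /h ->].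
Qed.

Lemma find_row_addcell_neq T i n m : m != n -> m \in flatten T ->
  find (fun r => m \in r) (addcell T i n) = find (fun r => m \in r) T.
Proof.
move=> /negbTE mn; elim: T i => [|r T IH] [|i] //=; rewrite mem_cat.
  by rewrite mem_rcons inE mn.
by case: ifP => //= _ /IH ->.
Qed.

(** Inverse of [addcell] that does not refer to the row; the outer filter drops a row that contained
    only [n]. *)
Definition delcell T n :=
  [seq r <- [seq [seq m <- r | m != n] | r <- T] | r != [::]].

Lemma delcell_id T n : tableau ltn T -> n \notin flatten T -> delcell T n = T.
Proof.
rewrite /delcell; elim: T => [|r T IH] //= /and4P[_ nr _ tT].
rewrite mem_cat negb_or => /andP[rn Tn].
have -> : [seq m <- r | m != n] = r.
  by apply/all_filterP/allP => m mr; apply: contraNneq rn => <-.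
by rewrite nr IH.
Qed.

Lemma addcellK T i n : tableau ltn T -> n \notin flatten T ->
  delcell (addcell T i n) n = T.
Proof.
rewrite /delcell; elim: T i => [|r T IH] i /=.
  by rewrite eqxx.
move=> /and4P[_ nr _ tT]; rewrite mem_cat negb_or => /andP[rn Tn].
have e : [seq m <- r | m != n] = r.
  by apply/all_filterP/allP => m mr; apply: contraNneq rn => <-.
case: i => [|i] /=; last by rewrite e nr IH.
rewrite filter_rcons eqxx /= e nr; congr cons.
exact: delcell_id.
Qed.

Lemma sorted_rcons_last r n : sorted ltn r -> all (leq^~ n) r -> n \in r ->
  r = rcons (take (size r).-1 r) n.
Proof.
case/lastP: r => // r a sr; rewrite all_rcons => /andP[an rn].
rewrite size_rcons -cats1 take_size_cat // cats1 mem_rcons inE.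
case/orP => [/eqP -> //|nr].
have : n < a.
  move: sr; rewrite -cats1 (sorted_pairwise ltn_trans) pairwise_cat /=.
  by rewrite allrel1r => /andP[/allP /(_ _ nr)].
by move: an; rewrite leqNgt => /negbTE ->.
Qed.

(** A maximal entry ends its row, as rows increase, and has no cell below it, as columns increase;
    its cell can therefore be removed. *)
Lemma addcellP T n : tableau ltn T -> all (leq^~ n) (flatten T) ->
  n \in flatten T ->
  exists Q i, [/\ T = addcell Q i n, tableau ltn Q & addable Q i].
Proof.
elim: T => [|r T IH] //= /and4P[sr nr /belowP[b1 b2] tT].
rewrite all_cat mem_cat => /andP[rn Tn].
case: (boolP (n \in r)) => [nr' _|_ /= nT].
  have er := sorted_rcons_last sr rn nr'; set r0 := take _ r in er.
  have szr : size r = (size r0).+1 by rewrite er size_rcons.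
  have hT : size (head [::] T) <= size r0.
    rewrite leqNgt; apply/negP => h.
    have := b2 _ h; rewrite [in nth 0 r]er nth_rcons ltnn eqxx.
    case: T h Tn {IH b1 b2 tT} => //= s T h; rewrite all_cat => /andP[/allP + _].
    by move=> /(_ _ (mem_nth 0 h)) /=; lia.
  case: (eqVneq r0 [::]) => [r00|nr0].
    exists [::], 0; split=> //=; rewrite er r00.
    case: T hT tT {IH b1 b2 Tn} => //= s T; rewrite r00 /= leqn0 size_eq0.
    by move=> /eqP ->.
  exists (r0 :: T), 0; split=> /=; rewrite -?er //.
  apply/and4P; split=> //; first exact: take_sorted.
  apply/belowP; split=> // c hc; have := b2 _ hc.
  by rewrite er nth_rcons (leq_trans hc hT).
have [Q [i [eT tQ aQ]]] := IH tT Tn nT.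
exists (r :: Q), i.+1; split=> /=; first by rewrite eT.
  rewrite sr nr tQ andbT /=; apply/belowP.
  move: b1 b2; rewrite eT head_addcell; case: Q {eT tQ aQ} => //= q Q.
  case: eqP => // _; rewrite size_rcons => b1 b2; split=> [|c hc]; first lia.
  by have := b2 c; rewrite nth_rcons hc; apply; lia.
move: b1 aQ; rewrite eT head_addcell /addable; case: i {eT} => [|i] //=.
by rewrite nth0 size_rcons => ->.
Qed.

End AddCell.

(** * The Robinson-Schensted correspondence for signed words *)

Notation letter := (nat + nat)%type.

Section SignedRSK.
Local Open Scope nat_scope.
Implicit Types (P Q : bitableau) (T : seq (seq nat)) (u : seq letter).

Definition lsign (a : letter) : bool := if a is inl _ then true else false.

Definition lval (a : letter) : nat := match a with inl i | inr i => i end.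

(** The shape after insertion is again that of a tableau, so the row that grew was shorter than the
    one above it, and [T] has the same row lengths. *)
Lemma addable_insrow (P : seq (seq nat)) T x : tableau leq P ->
  map size P = map size T -> addable T (insrow P x).
Proof.
move=> tP e; rewrite /addable; case E: (insrow P x) => [|i] //=.
have := tableau_size_le i (tableau_ins x tP).
have szE (A : seq (seq nat)) j : size (nth [::] A j) = nth 0 (map size A) j.
  case: (ltnP j (size A)) => h; first by rewrite (nth_map [::]).
  by rewrite !nth_default ?size_map.
by rewrite !szE shape_ins E -e !nth_incr_nth eqxx gtn_eqF.
Qed.

(** Lets shapes be compared through [nth] with default 0, the form in which [incr_nth] cancels. *)
Lemma no_zero_eq (s t : seq nat) : 0 \notin s -> 0 \notin t ->
  (forall i, nth 0 s i = nth 0 t i) -> s = t.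
Proof.
elim: s t => [|a s IH] [|b t] //=; rewrite ?inE ?negb_or.
- by move=> _ /andP[+ _] /(_ 0) /= e; rewrite -e.
- by move=> /andP[+ _] _ /(_ 0) /= e; rewrite e.
move=> /andP[_ s0] /andP[_ t0] e; have /= -> := e 0.
by congr cons; apply: IH => // i; have := e i.+1.
Qed.

Lemma tableau_no_zero ltr T : tableau ltr T -> 0 \notin map size T.
Proof.
elim: T => //= r T IH /and4P[_ nr _ /IH h]; rewrite inE negb_or h andbT.
by rewrite eq_sym size_eq0.
Qed.

Lemma ins_surj (P : seq (seq nat)) T i n : tableau leq P -> tableau ltn T ->
    addable T i -> map size P = map size (addcell T i n) ->
  exists (P0 : seq (seq nat)) x, [/\ P = ins P0 x, i = insrow P0 x, tableau leq P0 &
                   map size P0 = map size T].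
Proof.
move=> tP tT aT; rewrite shape_addcell // => e.
have szE (A : seq (seq nat)) j : size (nth [::] A j) = nth 0 (map size A) j.
  case: (ltnP j (size A)) => h; first by rewrite (nth_map [::]).
  by rewrite !nth_default ?size_map.
have iP : i < size P.
  rewrite -(size_map size) e size_incr_nth; case: ifP => //.
have cP : size (nth [::] P i.+1) < size (nth [::] P i).
  rewrite !szE e !nth_incr_nth eqxx ltn_eqF // -!szE.
  exact: tableau_size_le tT.
have [] := uninsP tP iP cP.
set P0 := (unins P i).2; set x := (unins P i).1 => tP0 eP ei.
exists P0, x; split=> //; apply: no_zero_eq.
- exact: tableau_no_zero tP0.
- exact: tableau_no_zero tT.
move=> j; have := congr1 (fun s => nth 0 s j) (shape_ins P0 x).
by rewrite eP e ei /= !nth_incr_nth => /eqP; rewrite eqn_add2l => /eqP.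
Qed.

Definition rsk_step n (st : bitableau * bitableau) (a : letter) :=
  let: (P, Q) := st in
  match a with
  | inl x => ((ins P.1 x, P.2), (addcell Q.1 (insrow P.1 x) n, Q.2))
  | inr x => ((P.1, ins P.2 x), (Q.1, addcell Q.2 (insrow P.2 x) n))
  end.

(** The recursion peels off the first letter whereas insertion adds a last one, hence the reversal;
    [rsk_rcons] is the equation used afterwards. *)
Fixpoint rsk_rev u : bitableau * bitableau :=
  if u is a :: u' then rsk_step (size u') (rsk_rev u') a
  else (([::], [::]), ([::], [::])).

Definition rsk u := rsk_rev (rev u).

Lemma rsk_rcons u a : rsk (rcons u a) = rsk_step (size u) (rsk u) a.
Proof. by rewrite /rsk rev_rcons /= size_rev. Qed.

Definition rsk_pair n (st : bitableau * bitableau) : bool :=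
  let: (P, Q) := st in
  [&& tableau leq P.1, tableau leq P.2, tableau ltn Q.1, tableau ltn Q.2,
      map size P.1 == map size Q.1, map size P.2 == map size Q.2 &
      perm_eq (flatten Q.1 ++ flatten Q.2) (iota 0 n)].

Lemma perm_iota_lt s t n : perm_eq (s ++ t) (iota 0 n) ->
  [/\ all (ltn^~ n) s, all (ltn^~ n) t, n \notin s & n \notin t].
Proof.
move=> /perm_mem h.
have lt m : m \in s ++ t -> m < n by rewrite h mem_iota.
split; try by apply/allP => m ms; apply: lt; rewrite mem_cat ms ?orbT.
all: by apply/negP => ms; have := lt n; rewrite ltnn mem_cat ms ?orbT => /(_ isT).
Qed.

Lemma rskP u : rsk_pair (size u) (rsk u).
Proof.
elim/last_ind: u => [|u a]; first by [].
rewrite rsk_rcons size_rcons; case: (rsk u) => P Q /=.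
move=> /and5P[tP1 tP2 tQ1 tQ2 /and3P[/eqP s1 /eqP s2 p]].
have [l1 l2 n1 n2] := perm_iota_lt p.
have pi : perm_eq (size u :: flatten Q.1 ++ flatten Q.2) (iota 0 (size u).+1).
  by rewrite -addn1 iotaD /= -cat1s perm_catC perm_cat2r.
case: a => x /=; apply/and5P; split=> //; try apply/and3P; try split=> //.
all: rewrite ?tableau_ins ?tableau_addcell ?shape_ins ?shape_addcell ?s1 ?s2 //.
all: try exact: addable_insrow.
  apply: perm_trans pi; rewrite -cat_cons perm_cat2r; exact: perm_addcell.
apply: perm_trans pi.
rewrite perm_sym -cat1s perm_catCA perm_cat2l perm_sym; exact: perm_addcell.
Qed.

Lemma perm_rsk u :
  perm_eq ([seq inl i | i <- flatten (rsk u).1.1] ++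
           [seq inr i | i <- flatten (rsk u).1.2]) u.
Proof.
elim/last_ind: u => [|u a] //; rewrite rsk_rcons.
case: (rsk u) => P Q /= IH; rewrite perm_sym perm_rcons perm_sym.
have {}IH : perm_eq (a :: [seq inl i | i <- flatten P.1] ++
    [seq inr i | i <- flatten P.2]) (a :: u) by rewrite perm_cons.
apply: perm_trans IH; case: a => x /=.
  by rewrite -cat_cons perm_cat2r -(map_cons inl) perm_map ?perm_ins.
by rewrite perm_sym -cat1s perm_catCA perm_cat2l cat1s -(map_cons inr) perm_sym
  perm_map ?perm_ins.
Qed.

Lemma rsk_sign u p : p < size u ->
  sign_tab (rsk u).2 p = lsign (nth (inl 0) u p).
Proof.
elim/last_ind: u => [|u a] //; rewrite rsk_rcons size_rcons nth_rcons.
have := rskP u; case: (rsk u) => P Q /=.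
move=> /and5P[_ _ _ _ /and3P[_ _ pe]] IH; rewrite ltnS leq_eqVlt.
have [_ _ n1 _] := perm_iota_lt pe.
rewrite /sign_tab in IH *.
case: (eqVneq p (size u)) => [-> _|np /= ps].
  rewrite ltnn; case: a => x /=; last by rewrite (negbTE n1).
  by rewrite (perm_mem (perm_addcell _ _ _)) inE eqxx.
rewrite ps -IH //; case: a => x //=.
by rewrite (perm_mem (perm_addcell _ _ _)) inE (negbTE np).
Qed.


Lemma row_of_rsk_last u a : row_of (rsk (rcons u a)).2 (size u) =
  insrow (if lsign a then (rsk u).1.1 else (rsk u).1.2) (lval a).
Proof.
have sg : sign_tab (rsk (rcons u a)).2 (size u) = lsign a.
  by rewrite rsk_sign ?size_rcons // nth_rcons ltnn eqxx.
rewrite /row_of sg rsk_rcons; have := rskP u; case: (rsk u) => P Q /=.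
move=> /and5P[tP1 tP2 _ _ /and3P[/eqP s1 /eqP s2 pe]].
have [_ _ n1 n2] := perm_iota_lt pe.
by case: a {sg} => x /=; apply: find_row_addcell => //; exact: addable_insrow.
Qed.

Lemma row_of_rsk_rcons u a p : p < size u ->
  row_of (rsk (rcons u a)).2 p = row_of (rsk u).2 p.
Proof.
move=> pu; have pu' : p < size (rcons u a) by rewrite size_rcons ltnW.
have np : p != size u by rewrite ltn_eqF.
have := rsk_sign pu; have := rsk_sign pu'; rewrite nth_rcons pu => e1 e2.
rewrite /row_of e1 e2; move: e2 {e1}; have := rskP u; rewrite rsk_rcons.
case: (rsk u) => P Q /= /and5P[_ _ _ _ /and3P[_ _ pe]].
have pQ : p \in flatten Q.1 ++ flatten Q.2.
  by rewrite (perm_mem pe) mem_iota ?ltnSn.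
rewrite mem_cat -/(sign_tab _ _) in pQ; case: (lsign _) => e; case: a {pu'} => x //=.
all: by apply: find_row_addcell_neq => //; rewrite /sign_tab in e pQ; move: pQ; rewrite e.
Qed.

(** Later insertions leave the recorded entries in their rows, so one may assume that [p.+1] is the
    last position. Two consecutive letters of equal sign go into the same tableau, and [insrow_lt]
    applies. *)
Lemma rsk_desc u p : p.+1 < size u ->
    lsign (nth (inl 0) u p) = lsign (nth (inl 0) u p.+1) ->
  (row_of (rsk u).2 p < row_of (rsk u).2 p.+1) =
  (lval (nth (inl 0) u p.+1) < lval (nth (inl 0) u p)).
Proof.
elim/last_ind: u => [|u b IH] //; rewrite size_rcons ltnS leq_eqVlt.
case/orP=> [/eqP pu|pu]; last first.
  rewrite !nth_rcons pu ltnW // => e.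
  by rewrite !row_of_rsk_rcons ?IH // ltnW.
rewrite pu; case/lastP: u pu {IH} => [|u a] //; rewrite size_rcons => -[->].
rewrite !nth_rcons size_rcons !ltnn !eqxx ltnSn => e.
have := row_of_rsk_last (rcons u a) b; rewrite size_rcons => ->.
rewrite row_of_rsk_rcons ?size_rcons // row_of_rsk_last -e rsk_rcons.
have := rskP u; case: (rsk u) => P Q /= /and5P[tP1 tP2 _ _ _].
by case: a b e => x [] y //= _; apply: insrow_lt.
Qed.

(** The largest entry of the recording bitableau reveals the sign of the last letter and the row
    where its insertion ended; [insK] and [addcellK] then undo the last step. *)
Lemma rsk_inj u v : size u = size v -> rsk u = rsk v -> u = v.
Proof.
elim/last_ind: u v => [|u a IH] v; case/lastP: v => [|v b] //;
  rewrite ?size_rcons // => -[e].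
move=> E; have sg : lsign a = lsign b.
  have hu : size u < size (rcons u a) by rewrite size_rcons.
  have hv : size u < size (rcons v b) by rewrite size_rcons e.
  have := rsk_sign hu; rewrite E (rsk_sign hv) !nth_rcons -e ltnn eqxx.
  by [].
have := row_of_rsk_last u a; have := row_of_rsk_last v b; rewrite -E -e -sg => ->.
move: E; rewrite !rsk_rcons -e.
have := rskP u; have := rskP v; rewrite -e.
move: (IH v e); case: (rsk u) => P Q; case: (rsk v) => P' Q' /= {}IH.
move=> /and5P[tP1' tP2' tQ1' tQ2' /and3P[_ _ pe']].
move=> /and5P[tP1 tP2 tQ1 tQ2 /and3P[_ _ pe]].
have [_ _ n1 n2] := perm_iota_lt pe; have [_ _ n1' n2'] := perm_iota_lt pe'.
case: a b sg => x [] y //= _ [].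
  move=> eP eP2 eQ eQ2 er.
  have [-> eP1] : (x, P.1) = (y, P'.1) by rewrite -(insK x tP1) -(insK y tP1') eP er.
  have eQ1 : Q.1 = Q'.1.
    by rewrite -(addcellK (insrow P.1 x) tQ1 n1) eQ addcellK.
  rewrite IH // (surjective_pairing P) (surjective_pairing Q) eP1 eP2 eQ1 eQ2.
  by rewrite -!surjective_pairing.
move=> eP1 eP eQ1 eQ er.
have [-> eP2] : (x, P.2) = (y, P'.2) by rewrite -(insK x tP2) -(insK y tP2') eP er.
have eQ2 : Q.2 = Q'.2.
  by rewrite -(addcellK (insrow P.2 x) tQ2 n2) eQ addcellK.
rewrite IH // (surjective_pairing P) (surjective_pairing Q) eP1 eP2 eQ1 eQ2.
  by rewrite -!surjective_pairing.
Qed.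

(** The part and the row of the largest recorded entry tell which tableau to uninsert from and at
    which corner. *)
Lemma rsk_surj n st : rsk_pair n st -> exists2 u, size u = n & rsk u = st.
Proof.
elim: n st => [|n IH] [[P1 P2] [Q1 Q2]].
  move=> /and5P[_ _ tQ1 tQ2 /and3P[/eqP s1 /eqP s2 /perm_size]].
  rewrite size_cat /= => /eqP; rewrite addn_eq0 => /andP[z1 z2].
  have nil ltr T : tableau ltr T -> size (flatten T) == 0 -> T = [::].
    by case: T => //= r T /and4P[_ + _ _]; rewrite size_cat addn_eq0 size_eq0 => /negbTE ->.
  have e1 := nil _ _ tQ1 z1; have e2 := nil _ _ tQ2 z2.
  exists [::] => //; rewrite /rsk /=.
  by move: s1 s2; rewrite /= in e1 e2 *; rewrite e1 e2; case: P1 => // _; case: P2.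
move=> /and5P[tP1 tP2 tQ1 tQ2 /and3P[/eqP s1 /eqP s2 pe0]].
have {pe0}pe : perm_eq (flatten Q1 ++ flatten Q2) (iota 0 n.+1) := pe0.
rewrite /= in tP1 tP2 tQ1 tQ2 s1 s2.
have le m : m \in flatten Q1 ++ flatten Q2 -> m <= n.
  by rewrite (perm_mem pe) mem_iota ?ltnSn.
have pi : perm_eq (n :: iota 0 n) (iota 0 n.+1).
  by rewrite -[n.+1]addn1 iotaD /= -cat1s perm_catC.
have : n \in flatten Q1 ++ flatten Q2 by rewrite (perm_mem pe) mem_iota ?ltnSn.
rewrite mem_cat => /orP[nQ|nQ].
  have lQ : all (leq^~ n) (flatten Q1).
    by apply/allP => m mQ; apply: le; rewrite mem_cat mQ.
  have [Q0 [i [eQ tQ0 aQ0]]] := addcellP tQ1 lQ nQ.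
  rewrite eQ in s1; have [P0 [x [eP ei tP0 s0]]] := ins_surj tP1 tQ0 aQ0 s1.
  have pe0 : perm_eq (flatten Q0 ++ flatten Q2) (iota 0 n).
    rewrite -(perm_cons n); apply: perm_trans (perm_trans pe _); last by rewrite perm_sym.
    by rewrite eQ -cat_cons perm_cat2r perm_sym perm_addcell.
  have [|u su eu] := IH ((P0, P2), (Q0, Q2)).
    by rewrite /= tP0 tP2 tQ0 tQ2 s0 s2 !eqxx.
  exists (rcons u (inl x)); first by rewrite size_rcons su.
  by rewrite rsk_rcons eu su /= -eP -ei -eQ.
have lQ : all (leq^~ n) (flatten Q2).
  by apply/allP => m mQ; apply: le; rewrite mem_cat mQ orbT.
have [Q0 [i [eQ tQ0 aQ0]]] := addcellP tQ2 lQ nQ.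
rewrite eQ in s2; have [P0 [x [eP ei tP0 s0]]] := ins_surj tP2 tQ0 aQ0 s2.
have pe0 : perm_eq (flatten Q1 ++ flatten Q0) (iota 0 n).
  rewrite -(perm_cons n); apply: perm_trans (perm_trans pe _); last by rewrite perm_sym.
  by rewrite -cat1s perm_catCA eQ perm_cat2l perm_sym perm_addcell.
have [|u su eu] := IH ((P1, P0), (Q1, Q0)).
  by rewrite /= tP0 tP1 tQ0 tQ1 s0 s1 !eqxx.
exists (rcons u (inr x)); first by rewrite size_rcons su.
by rewrite rsk_rcons eu su /= -eP -ei -eQ.
Qed.

End SignedRSK.

(** * Schur expansion of word series *)

Definition word_asc n (u : seq letter) : {set 'I_n} :=
  sascB (fun i : 'I_n => lsign (nth (inl 0%N) u i))
        (fun i j : 'I_n => lval (nth (inl 0%N) u j) < lval (nth (inl 0%N) u i))%N.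

(** Agreement of [D] and [D'] is asked only for consecutive letters of equal sign, which is all that
    [rsk_desc] provides. *)
Lemma eq_sascB n (eps eps' : 'I_n -> bool) (D D' : rel 'I_n) :
    eps =1 eps' ->
    (forall i j : 'I_n, j = i.+1 :> nat -> eps i = eps j -> D i j = D' i j) ->
  sascB eps D = sascB eps' D'.
Proof.
move=> e d; apply/setP => i; rewrite /sascB /sdesB /sdes !inE -e.
congr (~~ (_ || _)); apply: eq_existsb => j.
case: (j =P i.+1 :> nat) => //= ij; rewrite -!e; congr (_ || _).
by case: (eps i =P eps j) => //= eij; exact: d.
Qed.

Lemma AscB_tab_rsk u : AscB_tab (size u) (rsk u).2 = word_asc (size u) u.
Proof.
apply: eq_sascB => [i|i j ij]; first exact: rsk_sign.
by rewrite !rsk_sign // !ij => /rsk_desc -> //; rewrite -ij.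
Qed.

Definition word_class n b k : set (seq letter) :=
  [set u | size u = n /\ Stab_card b k (word_asc n u)].

Section TableauPredicate.
Local Open Scope nat_scope.

(** Nonzero parts exclude empty rows, and the decrease of the parts gives the length condition in
    [below]. *)
Lemma is_tableauP ltr la T : is_partition la ->
  is_tableau ltr la T <-> tableau ltr T /\ map size T = la.
Proof.
elim: T la => [|r T IH] la pla.
  by split=> [[<- _ _]|[_ <-]] //; split=> // r c; rewrite nth_nil.
case: la pla => [|a la]; first by split=> [[]|[]].
move=> pla; have {}pla' : is_partition la.
  move: pla; rewrite /is_partition inE negb_or => /andP[/path_sorted -> /andP[_ ->]].
  by [].
have a0 : a != 0.
  by move: pla; rewrite /is_partition inE negb_or eq_sym => /and3P[].
have hd : head 0 la <= a.
  by case: (la) pla => //= c l; rewrite /is_partition /= => /andP[/andP[]].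
have hT : map size T = la -> size (head [::] T) = head 0 la.
  by move=> <-; case: (T).
split=> [[/= [sr sT] /andP[srt srtT] col]|[/= /and4P[srt nr /belowP[b1 b2] tT] [sr sT]]].
  have [] := (IH la pla').1.
    by split=> // i c; exact: (col i.+1 c).
  move=> tT _; split; last by rewrite sr sT.
  rewrite srt tT andbT -size_eq0 sr a0 /=; apply/belowP; rewrite sr hT //.
  split=> // c; rewrite -(hT sT) => hc.
  by have := col 0 c; rewrite /= nth0; apply.
have [_ srtT col] := (IH la pla').2 (conj tT sT).
split=> /=; rewrite ?sr ?sT ?srt //= => -[|i] c //=; last exact: col.
by rewrite nth0; exact: b2.
Qed.

Lemma tableau_shape ltr T : tableau ltr T -> is_partition (map size T).
Proof.
move=> tT; rewrite /is_partition (tableau_no_zero tT) andbT.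
elim: T tT => //= r T IH /and4P[_ _ /belowP[b1 _] /IH].
by case: T b1 {IH} => //= s T -> ->.
Qed.

Lemma finite_bipartition n : finite_set [set p | is_bipartition n p].
Proof.
(* Parts are positive, so each partition has at most [n] parts, each at most [n]. *)
pose A := \bigcup_(m in `I_n.+1)
  [set s : seq nat | size s = m /\ forall x, x \in s -> `I_n.+1 x].
have fA : finite_set A.
  by apply: bigcup_finite => [|m _]; [exact: finite_II|exact/finite_seqs/finite_II].
have inA s : 0 \notin s -> sumn s <= n -> A s.
  move=> s0 sn; exists (size s) => /=.
    rewrite ltnS; apply: leq_trans sn; elim: s s0 => //= x s IH.
    rewrite inE negb_or => /andP[x0 /IH]; lia.
  split=> // x xs /=; rewrite ltnS; apply: leq_trans sn.
  elim: s xs {s0} => //= y s IH; rewrite inE => /orP[/eqP ->|/IH]; lia.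
apply: sub_finite_set (finite_setX fA fA) => -[la mu] /=.
move=> /and3P[/= /andP[_ la0] /andP[_ mu0] /eqP e].
by split; apply: inA => //=; lia.
Qed.

End TableauPredicate.

Lemma inl_flatten_inj la (g : nat -> letter) ltr : injective g ->
  set_inj [set T | is_tableau ltr la T] (fun T => map g (flatten T)).
Proof.
move=> gi T1 T2 /set_mem[s1 _ _] /set_mem[s2 _ _] /(inj_map gi) e.
by rewrite -(flattenK T1) -(flattenK T2) e /shape s1 s2.
Qed.

Lemma schur_gser (g : nat -> letter) la :
  schur (fun i => mser_var (g i)) la =
  gser [set T | is_tableau leq la T] (fun T => map g (flatten T)).
Proof.
apply/funext => m; apply: eq_fsbigr => T _.
by rewrite -prod_mser_var big_map.
Qed.

Definition st_word (st : bitableau * bitableau) : seq letter :=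
  [seq inl i | i <- flatten st.1.1] ++ [seq inr i | i <- flatten st.1.2].

Definition st_shape (st : bitableau * bitableau) : seq nat * seq nat :=
  (map size st.1.1, map size st.1.2).

Lemma rsk_pairP n st p : is_bipartition n p ->
  rsk_pair n st && (st_shape st == p) <->
  [/\ is_tableau leq p.1 st.1.1, is_tableau leq p.2 st.1.2 & is_SYT2 n p st.2].
Proof.
case: st => P Q /and3P[p1 p2 _]; split.
  move=> /andP[/and5P[tP1 tP2 tQ1 tQ2 /and3P[/eqP s1 /eqP s2 pe]] /eqP ep].
  rewrite -ep in p1 p2 *.
  by split; [| |split=> //]; apply/is_tableauP; rewrite //= -?s1 -?s2.
move=> [/(is_tableauP _ _ p1) /= [tP1 s1] /(is_tableauP _ _ p2) /= [tP2 s2]].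
move=> [/(is_tableauP _ _ p1) /= [tQ1 s3] /(is_tableauP _ _ p2) /= [tQ2 s4] /= pe].
by rewrite tP1 tP2 tQ1 tQ2 s1 s2 s3 s4 pe /st_shape /= s1 s2 -surjective_pairing !eqxx.
Qed.

Lemma rsk_pair_shape n st : rsk_pair n st -> is_bipartition n (st_shape st).
Proof.
case: st => P Q /and5P[tP1 tP2 tQ1 tQ2 /and3P[/eqP s1 /eqP s2 pe]].
rewrite /is_bipartition /= (tableau_shape tP1) (tableau_shape tP2) /= s1 s2.
by have := perm_size pe; rewrite size_cat !size_flatten size_iota => ->.
Qed.

Lemma finite_SYT2 n p : finite_set [set Q | is_SYT2 n p Q].
Proof.
pose A k := [set s : seq nat | size s = k /\ forall x, x \in s -> `I_n x].
have fA k : finite_set (A k) by exact/finite_seqs/finite_II.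
apply: sub_finite_set (finite_image (fun s => (reshape p.1 s.1, reshape p.2 s.2))
  (finite_setX (fA (sumn p.1)) (fA (sumn p.2)))).
move=> [Q1 Q2] /= [[/= s1 _ _] [/= s2 _ _] pe].
have lt x : x \in flatten Q1 ++ flatten Q2 -> (x < n)%N.
  by rewrite (perm_mem pe) mem_iota.
exists (flatten Q1, flatten Q2); last by rewrite /= -s1 -s2 !flattenK.
by split; (split; [rewrite /= size_flatten /shape ?s1 ?s2|]) => // x xQ;
  apply: lt; rewrite mem_cat xQ ?orbT.
Qed.

Lemma inl_inj (A B : Type) : injective (@inl A B).
Proof. by move=> x y []. Qed.

Lemma inr_inj (A B : Type) : injective (@inr A B).
Proof. by move=> x y []. Qed.

Lemma schurM la mu : schur xvar la * schur yvar mu =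
  gser ([set T | is_tableau leq la T] `*` [set T | is_tableau leq mu T])
    (fun p => [seq inl i | i <- flatten p.1] ++ [seq inr i | i <- flatten p.2]).
Proof.
have ex : schur xvar la = _ := schur_gser inl la.
have ey : schur yvar mu = _ := schur_gser inr mu.
transitivity (gser [set T | is_tableau leq la T]
                (fun T => [seq inl i | i <- flatten T] : seq letter) *
              gser [set T | is_tableau leq mu T]
                (fun T => [seq inr i | i <- flatten T] : seq letter) : xyser).
  exact: (congr2 *%R ex ey).
by apply: gserM; apply/finfib_inj/inl_flatten_inj; [exact: inl_inj|exact: inr_inj].
Qed.

(** The ascent set depends on the recording bitableau only. For a fixed shape the pairs thus form a
    product: all semistandard pairs, giving [schurM], times the bitableaux counted by [dcoef]. *)
Lemma gamma_words b n k : gamma b n k = gser (word_class n b k) id.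
Proof.
pose I := [set st | rsk_pair n st /\ Stab_card b k (AscB_tab n st.2)].
have bij : set_bij (word_class n b k) I rsk.
  split.
  - move=> u [su]; rewrite /I /= -su AscB_tab_rsk => h.
    by split=> //; exact: rskP.
  - by move=> u v /set_mem[su _] /set_mem[sv _]; apply: rsk_inj; rewrite su sv.
  - move=> st [/rsk_surj [u su eu] h]; exists u => //; split=> //.
    by move: h; rewrite -eu -su AscB_tab_rsk.
have wtE u : wt (st_word (rsk u)) = wt u by exact/perm_wt/perm_rsk.
have fW : finfib (word_class n b k) id by exact: finfib_inj.
have fI : finfib I st_word.
  move=> m; apply: sub_finite_set (finite_image rsk (fW m)) => st [Ist e].
  have [_ _ /(_ st Ist) [u uW eu]] := bij; exists u; last exact: eu.
  by split; [exact: uW|rewrite -e -eu; exact/esym/wtE].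
rewrite (eq_gser_bij bij (g := st_word)) //.
have fB := finite_bipartition n.
rewrite (@gser_partition _ _ _ _ _ _ st_shape
  (fset_set [set p | is_bipartition n p])) //; last first.
  by move=> st [/rsk_pair_shape h _]; rewrite in_fset_set // inE.
rewrite /gamma fsbig_finite // big_seq [RHS]big_seq; apply: eq_bigr => p.
rewrite in_fset_set // inE => pB.
rewrite schurM /dcoef gser_mulrn; first last.
- by apply: sub_finite_set (finite_SYT2 n p) => Q [].
- apply: (@finfibX _ _ _ _ _ (fun T => [seq inl i | i <- flatten T] : seq letter)
     (fun T => [seq inr i | i <- flatten T] : seq letter)); apply/finfib_inj/inl_flatten_inj;
    [exact: inl_inj|exact: inr_inj].
apply: eq_gser => //; apply/seteqP; split=> -[P Q] /=.
  move=> [[h1 h2] [h3 h4]].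
  have /andP[h /eqP hs] := (rsk_pairP (P, Q) pB).2 (And3 h1 h2 h3).
  by [].
move=> [[h1 h2] h3].
by have [] := (rsk_pairP (P, Q) pB).1; rewrite ?h1 /= ?h3 ?eqxx.
Qed.

(** * Signed permutations and words *)

Section SignedPermutations.
Variable n : nat.
Implicit Types (w : {perm sletter n}) (i : {ffun 'I_n -> nat}) (u : seq letter).

Definition mkletter (s : bool) (k : nat) : letter := if s then inl k else inr k.

Lemma mkletterK (a : letter) : mkletter (lsign a) (lval a) = a.
Proof. by case: a. Qed.

Lemma lsign_mk s k : lsign (mkletter s k) = s. Proof. by case: s. Qed.

Lemma lval_mk s k : lval (mkletter s k) = k. Proof. by case: s. Qed.

Lemma hyperoctE w j s : w \in hyperoct n ->
  w (j, s) = (abs_perm w j, sign_perm w j == s).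
Proof.
rewrite inE => /forallP /(_ (j, true)) /eqP /= e.
rewrite /abs_perm /sign_perm; case: s; first by case: (w _) => a [].
by rewrite (_ : (j, false) = sopp (j, true)) // e; case: (w _) => a [].
Qed.

Lemma hyperoct_invE w j : w \in hyperoct n ->
  (w^-1)%g (abs_perm w j, true) = (j, sign_perm w j).
Proof.
move=> wB; apply: (@perm_inj _ w); rewrite permKV hyperoctE //.
by rewrite eqxx.
Qed.

Lemma abs_perm_inj w : w \in hyperoct n -> injective (abs_perm w).
Proof.
move=> wB j l e; have := hyperoct_invE j wB.
by rewrite e hyperoct_invE // => -[].
Qed.

Lemma abs_perm_surj w (p : 'I_n) : w \in hyperoct n -> exists j, p = abs_perm w j.
Proof.
move=> wB; have [g _ gK] := injF_bij (abs_perm_inj wB).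
by exists (g p); rewrite gK.
Qed.

Lemma abs_permK w j : w \in hyperoct n -> abs_perm w^-1%g (abs_perm w j) = j.
Proof. by move=> wB; rewrite {1}/abs_perm hyperoct_invE. Qed.

Lemma sign_permV w j : w \in hyperoct n ->
  sign_perm w^-1%g (abs_perm w j) = sign_perm w j.
Proof. by move=> wB; rewrite {1}/sign_perm hyperoct_invE. Qed.

Definition word_of (wi : {perm sletter n} * {ffun 'I_n -> nat}) : seq letter :=
  [seq mkletter (sign_perm wi.1^-1%g p) (wi.2 (abs_perm wi.1^-1%g p)) | p <- enum 'I_n].

Lemma size_word_of wi : size (word_of wi) = n.
Proof. by rewrite size_map size_enum_ord. Qed.

Lemma nth_word_of w i (j : 'I_n) : w \in hyperoct n ->
  nth (inl 0%N) (word_of (w, i)) (abs_perm w j) = mkletter (sign_perm w j) (i j).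
Proof.
move=> wB; rewrite (nth_map (abs_perm w j)) ?size_enum_ord //.
by rewrite nth_ord_enum /= abs_permK // sign_permV.
Qed.

(* The order in which the letters of [u] are visited: by index, the negative
   letters before the positive ones, then from left to right. *)
Definition key u (p : 'I_n) : nat :=
  ((lval (nth (inl 0) u p)).*2 + lsign (nth (inl 0) u p)) * n + p.

(** As [p < n], comparing keys is comparing pairs lexicographically. *)
Lemma key_lt (a b : nat) (p q : 'I_n) : (a * n + p < b * n + q)%N =
  (a < b)%N || (a == b) && (p < q)%N.
Proof.
have := ltn_ord p; have := ltn_ord q => hq hp.
case: (ltngtP a b) => /= [ab|ba|->]; last by rewrite ltn_add2l.
  by nia.
by apply/negbTE; nia.
Qed.

Lemma key_inj u : injective (key u).
Proof.
move=> p q /(congr1 (modn^~ n)); rewrite !modnMDl !modn_small //.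
exact: val_inj.
Qed.

Definition compat w i := forall j l : 'I_n, l = j.+1 :> nat ->
  (i j <= i l)%N /\ (j \in Des_perm w -> (i j < i l)%N).

Lemma Des_permE w (j l : 'I_n) : l = j.+1 :> nat -> (j \in Des_perm w) =
  (sign_perm w j && ~~ sign_perm w l) ||
  ((sign_perm w j == sign_perm w l) && (abs_perm w l < abs_perm w j)%N).
Proof.
move=> e; rewrite inE; apply/existsP/idP => [[l' /andP[/eqP e']]|h].
  by rewrite (_ : l' = l) //; apply: val_inj; rewrite /= e e'.
by exists l; rewrite e eqxx.
Qed.

(** Compatibility says exactly that [w] visits the positions of its word in increasing order of
    [key]; both inverting directions of [word_of] rest on this. *)
Lemma compatP w i : w \in hyperoct n ->
  compat w i <-> forall j l : 'I_n, l = j.+1 :> nat ->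
    (key (word_of (w, i)) (abs_perm w j) < key (word_of (w, i)) (abs_perm w l))%N.
Proof.
move=> wB; have E (j l : 'I_n) : l = j.+1 :> nat ->
    (key (word_of (w, i)) (abs_perm w j) < key (word_of (w, i)) (abs_perm w l))%N
    <-> ((i j <= i l)%N /\ (j \in Des_perm w -> (i j < i l)%N)).
  move=> e; rewrite key_lt !nth_word_of // !lsign_mk !lval_mk (Des_permE _ e).
  have : (abs_perm w j != abs_perm w l :> nat).
    apply/eqP => /val_inj /(abs_perm_inj wB) ejl.
    by move: e; rewrite ejl => /eqP; rewrite -[X in X == _]addn0 -addn1 eqn_add2l.
  case: (sign_perm w j); case: (sign_perm w l) => /=; lia.
by split=> h j l e; [apply/(E _ _ e)/h|apply/(E _ _ e)/h].
Qed.

Lemma ord_homo_lt (f : 'I_n -> nat) :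
  (forall j l : 'I_n, l = j.+1 :> nat -> (f j < f l)%N) ->
  forall j l : 'I_n, (j < l)%N -> (f j < f l)%N.
Proof.
move=> h j [l ln] /= jl; elim: l ln jl => // l IH ln.
rewrite ltnS leq_eqVlt => /orP[/eqP e|jl]; first by apply: h; rewrite /= e.
by apply: ltn_trans (IH (ltnW ln) jl) _; apply: h.
Qed.

(** The inverse of [w] tells when a position is visited. For neighbouring positions of equal sign
    this compares letters, and a tie goes to the left position, so equal letters form an ascent on
    both sides. *)
Lemma AscB_word_of w i : w \in hyperoct n -> compat w i ->
  AscB_perm w^-1%g = word_asc n (word_of (w, i)).
Proof.
move=> wB /(compatP i wB) /ord_homo_lt hk.
have kE (j l : 'I_n) : (j < l)%N =
  (key (word_of (w, i)) (abs_perm w j) < key (word_of (w, i)) (abs_perm w l))%N.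
  case: (ltngtP j l) => [/hk ->//|/hk lj|/val_inj ->]; last by rewrite ltnn.
  by apply/esym/negbTE; rewrite -leqNgt ltnW.
apply: eq_sascB => [p|p q pq].
  have [j ->] := abs_perm_surj p wB.
  by rewrite nth_word_of // sign_permV // lsign_mk.
have [j ej] := abs_perm_surj p wB; have [l el] := abs_perm_surj q wB.
move: pq; rewrite ej el !abs_permK // !sign_permV // => pq es.
rewrite kE key_lt !nth_word_of // !lsign_mk !lval_mk es; lia.
Qed.

(** Both permutations list the positions in strictly increasing order of the same key, so the lists
    coincide; signs and indices are then read off the letters. *)
Lemma word_of_inj wi wi' : wi.1 \in hyperoct n -> wi'.1 \in hyperoct n ->
  compat wi.1 wi.2 -> compat wi'.1 wi'.2 -> word_of wi = word_of wi' -> wi = wi'.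
Proof.
case: wi wi' => [w i] [w' i'] /= wB wB' /(compatP i wB) /ord_homo_lt h.
move=> /(compatP i' wB') /ord_homo_lt h' e; rewrite -e in h'.
pose u := word_of (w, i).
have srt (v : {perm sletter n}) :
    (forall j l : 'I_n, (j < l)%N -> (key u (abs_perm v j) < key u (abs_perm v l))%N) ->
    sorted (relpre (key u) ltn) [seq abs_perm v j | j <- enum 'I_n].
  move=> hv; apply: (homo_sorted (e := fun j l : 'I_n => (j < l)%N)).
    by move=> j l; exact: hv.
  have := iota_ltn_sorted 0 n; rewrite -val_enum_ord sorted_map.
  by [].
have ae : abs_perm w =1 abs_perm w'.
  have perm (v : {perm sletter n}) : v \in hyperoct n ->
      [seq abs_perm v j | j <- enum 'I_n] =i 'I_n.
    by move=> vB p; have [j ->] := abs_perm_surj p vB; rewrite map_f ?mem_enum.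
  have := irr_sorted_eq (leT := relpre (key u) ltn)
    _ _ (srt _ h) (srt _ h') (fun p => etrans (perm _ wB p) (esym (perm _ wB' p))).
  move=> /(_ _ _) E j; have {}E := E (fun a b c => @ltn_trans _ _ _) (fun a => ltnn _).
  by move/eq_in_map: E; apply; rewrite mem_enum.
have le j : mkletter (sign_perm w j) (i j) = mkletter (sign_perm w' j) (i' j).
  by rewrite -!nth_word_of // -ae e.
have se j : sign_perm w j = sign_perm w' j.
  by have := congr1 lsign (le j); rewrite !lsign_mk.
congr (_, _); last first.
  by apply/ffunP => j; have := congr1 lval (le j); rewrite !lval_mk.
by apply/permP => -[j s]; rewrite !hyperoctE // ae se.
Qed.

Lemma word_of_surj u : size u = n ->
  exists2 wi, wi.1 \in hyperoct n /\ compat wi.1 wi.2 & word_of wi = u.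
Proof.
move=> su; pose s := sort (relpre (key u) leq) (enum 'I_n).
have ps : perm_eq s (enum 'I_n) by rewrite perm_sort.
have szs : size s = n by rewrite (perm_size ps) size_enum_ord.
have us : uniq s by rewrite (perm_uniq ps) enum_uniq.
pose sg (j : 'I_n) := nth j s j.
have sg_inj : injective sg.
  move=> j l; rewrite /sg (set_nth_default j) ?szs // => /eqP.
  by rewrite nth_uniq ?szs // => /eqP/val_inj.
pose a (j : 'I_n) := nth (inl 0%N) u (sg j).
(* On booleans standing for signs, [==] is multiplication, so [f] commutes with [sopp]. *)
pose f (x : sletter n) : sletter n := (sg x.1, lsign (a x.1) == x.2).
have f_inj : injective f.
  move=> [j b] [l c] [/= /sg_inj -> /=].
  by case: (lsign _); case: b; case: c.
have wB : perm f_inj \in hyperoct n.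
  rewrite inE; apply/forallP => -[j b]; rewrite !permE /f /sopp /=.
  by apply/eqP; congr (_, _); case: (lsign _); case: b.
pose i : {ffun 'I_n -> nat} := [ffun j => lval (a j)].
have aE j : abs_perm (perm f_inj) j = sg j by rewrite /abs_perm permE.
have sE j : sign_perm (perm f_inj) j = lsign (a j).
  by rewrite /sign_perm permE /=; case: (lsign _).
have wu : word_of (perm f_inj, i) = u.
  apply: (@eq_from_nth _ (inl 0%N)); rewrite size_word_of // => p pn.
  have [j ej] := abs_perm_surj (Ordinal pn) wB.
  have := nth_word_of i j wB; rewrite -ej /= => ->.
  by rewrite sE ffunE mkletterK /a -aE -ej.
exists (perm f_inj, i) => //; split=> //=; apply/compatP => // j l e.
rewrite wu !aE ltn_neqAle; apply/andP; split.
  apply/eqP => /key_inj /sg_inj ejl; move: e; rewrite ejl; lia.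
have := sort_sorted (leT := relpre (key u) leq) (fun p q => leq_total _ _) (enum 'I_n).
rewrite -/s => /(sortedP j) /(_ j); rewrite szs -e => /(_ (ltn_ord l)).
by rewrite /= /sg (set_nth_default j) ?szs.
Qed.

Lemma perm_word_of w i : w \in hyperoct n ->
  perm_eq [seq mkletter (sign_perm w j) (i j) | j <- enum 'I_n] (word_of (w, i)).
Proof.
move=> wB; have pe : perm_eq [seq abs_perm w j | j <- enum 'I_n] (enum 'I_n).
  apply: uniq_perm; rewrite ?(map_inj_uniq (abs_perm_inj wB)) ?enum_uniq // => p.
  by have [j ->] := abs_perm_surj p wB; rewrite map_f ?mem_enum.
have -> : [seq mkletter (sign_perm w j) (i j) | j <- enum 'I_n] =
    [seq mkletter (sign_perm w^-1%g p) (i (abs_perm w^-1%g p))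
       | p <- [seq abs_perm w j | j <- enum 'I_n]].
  by rewrite -map_comp; apply: eq_map => j /=; rewrite abs_permK // sign_permV.
exact: perm_map.
Qed.

End SignedPermutations.

Lemma F_sDes_gser n (w : {perm sletter n}) :
  F_sDes w = gser [set i | compat w i]
    (fun i : {ffun 'I_n -> nat} =>
       [seq mkletter (sign_perm w j) (i j) | j <- enum 'I_n]).
Proof.
apply/funext => m; apply: eq_fsbigr => i _.
rewrite -prod_mser_var big_map big_enum; congr (_ m); apply: eq_bigr => j _.
by case: (sign_perm w j).
Qed.

Lemma sum_F_sDes n b k :
  \sum_(w in hyperoct n | Stab_card b k (AscB_perm w^-1%g)) F_sDes w =
  gser (word_class n b k) id.
Proof.
pose X := [set wi : {perm sletter n} * {ffun 'I_n -> nat} |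
  [/\ wi.1 \in hyperoct n, compat wi.1 wi.2 &
     Stab_card b k (AscB_perm wi.1^-1%g)]].
have injX : set_inj X (@word_of n).
  by move=> wi wi' /set_mem[h1 h2 _] /set_mem[h3 h4 _]; exact: word_of_inj.
have bij : set_bij X (word_class n b k) (@word_of n).
  split=> //.
    move=> [w i] [/= wB c h]; split; first exact: size_word_of.
    by rewrite -(AscB_word_of wB c).
  move=> u [su h]; have [[w i] [/= wB c] eu] := word_of_surj su.
  by exists (w, i) => //; split=> //=; rewrite (AscB_word_of wB c) eu.
rewrite -(eq_gser_bij (f := @word_of n) bij) //.
rewrite (@gser_partition _ _ _ _ _ _ fst
  [seq w <- index_enum _ | (w \in hyperoct n) && Stab_card b k (AscB_perm w^-1%g)]).
- rewrite big_filter; apply: eq_bigr => w /andP[wB h].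
  rewrite F_sDes_gser; apply: (eq_gser_bij (h := fun i => (w, i))); last first.
    by move=> i _; apply/perm_wt; rewrite perm_sym perm_word_of.
  split.
  - by move=> i c; split=> //; split.
  - by move=> i j _ _ [].
  - by move=> [w' i] [[/= _ c _] e]; exists i; rewrite -e.
- exact: finfib_inj.
- exact/filter_uniq/index_enum_uniq.
- by move=> wi [h1 _ h2]; rewrite mem_filter h1 h2 mem_index_enum.
Qed.

(** * Ascent patterns *)

Section AscentPatterns.
Implicit Types (u v : seq letter) (c : seq bool).

Definition ascent (a b : letter) : bool :=
  (~~ lsign a && lsign b) || ((lsign a == lsign b) && (lval a <= lval b)%N).

(* The last bit records whether [n] is in [Asc_B], that is whether the last
   letter is negative. *)
Fixpoint asc_bits u : seq bool :=
  if u is a :: u' then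
    (if u' is b :: _ then ascent a b else ~~ lsign a) :: asc_bits u'
  else [::].

Lemma size_asc_bits u : size (asc_bits u) = size u.
Proof. by elim: u => //= a u ->. Qed.

Lemma nth_asc_bits u i : (i < size u)%N -> nth false (asc_bits u) i =
  if (i.+1 < size u)%N then ascent (nth (inl 0%N) u i) (nth (inl 0%N) u i.+1)
  else ~~ lsign (nth (inl 0%N) u i).
Proof.
elim: u i => // a u IH [|i] /=; first by case: u {IH}.
by move=> iu; rewrite IH.
Qed.

Lemma mem_word_asc n u (i : 'I_n) : size u = n ->
  (i \in word_asc n u) = nth false (asc_bits u) i.
Proof.
move=> su; rewrite nth_asc_bits ?su // !inE negb_or.
case: ltnP => [i1|i1]; last first.
  have -> : i.+1 == n by rewrite eqn_leq i1 andbT ltn_ord.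
  rewrite andbC; case: (lsign _) => //=; apply/existsP => -[j /andP[/eqP e _]].
  by move: (ltn_ord j); rewrite e ltnNge i1.
rewrite (ltn_eqF i1) /= andbT negb_exists; apply/forallP/idP => [h|h j].
  have := h (Ordinal i1); rewrite /= eqxx /= negb_or !negb_and negbK /ascent -leqNgt.
  by case: (lsign _); case: (lsign _).
case: (j =P i.+1 :> nat) => //= ->.
by move: h; rewrite negb_or !negb_and negbK /ascent -leqNgt; case: (lsign _); case: (lsign _).
Qed.

(** Bit [(size u).-1] is left out: alone, [u] has there the sign of its last letter, but in [u ++ v]
    it becomes a comparison with the first letter of [v] if there is one. *)
Lemma asc_bits_cat u v :
  take (size u).-1 (asc_bits (u ++ v)) = take (size u).-1 (asc_bits u) /\
  drop (size u) (asc_bits (u ++ v)) = asc_bits v.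
Proof.
split; last by elim: u => //=; rewrite drop0.
by elim: u => [|a [|b u] IH] //=; rewrite ?take0 // -IH.
Qed.

Definition Wser c : xyser := gser [set u | asc_bits u = c] id.

Lemma wser_partition n (C : pred (seq bool)) :
  gser [set u | size u = n /\ C (asc_bits u)] id =
  \sum_(c : n.-tuple bool | C c) Wser c.
Proof.
rewrite (@gser_partition _ _ _ _ _ _ asc_bits
  (map (@tval n bool) (seq.filter (fun c : n.-tuple bool => C c) (index_enum _)))).
- rewrite big_map big_filter; apply: eq_bigr => c Cc.
  apply: eq_gser => //; apply/seteqP; split=> u /=; first by case.
  by move=> e; rewrite -(size_asc_bits u) e size_tuple.
- exact: finfib_inj.
- rewrite map_inj_uniq; last exact: val_inj.
  exact/filter_uniq/index_enum_uniq.
- move=> u [su Cu]; have su' : size (asc_bits u) == n by rewrite size_asc_bits su.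
  by apply/mapP; exists (Tuple su') => //; rewrite mem_filter Cu mem_index_enum.
Qed.

(* [desc r] is the homogeneous part of degree [r] of [E(x; z) E(y; z)]. *)
Definition desc r : xyser :=
  gser [set u | size u = r /\ all negb (take r.-1 (asc_bits u))] id.

(** Words are cut after [r] letters; bit [r.-1] at the cut is unconstrained. *)
Lemma descM r c :
  desc r * Wser c =
  \sum_(c' : (r + size c).-tuple bool |
         all negb (take r.-1 c') && (drop r c' == c)) Wser c'.
Proof.
rewrite -(wser_partition _ (fun c' => all negb (take r.-1 c') && (drop r c' == c))).
rewrite /desc /Wser gserM; try exact: finfib_inj.
apply: (eq_gser_bij (h := fun p => p.1 ++ p.2)) => //; split.
- move=> [u v] /= [[su hu] hv].
  have [e1 e2] := asc_bits_cat u v; rewrite su in e1 e2.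
  rewrite e1 e2 hu hv eqxx size_cat su -(size_asc_bits v) hv; split=> //.
- move=> [u v] [u' v'] /set_mem[/= [su _] _] /set_mem[/= [su' _] _] /eqP.
  by rewrite eqseq_cat ?su ?su' // => /andP[/eqP -> /eqP ->].
- move=> u /= [su /andP[h /eqP hd]].
  have [] := asc_bits_cat (take r u) (drop r u).
  have -> : size (take r u) = r by rewrite size_take_min su; apply/minn_idPl; lia.
  rewrite cat_take_drop => e1 e2; exists (take r u, drop r u); last exact: cat_take_drop.
  split=> /=; last by rewrite -e2.
  split; last by rewrite -e1.
  by rewrite size_take_min su; apply/minn_idPl; lia.
Qed.

(** Linear in [g], so identities between weights of patterns pass to series. *)
Definition Phi n (g : seq bool -> {poly xyser}) : {poly xyser} :=
  \sum_(c : n.-tuple bool) g c * (Wser c)%:P.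

Lemma eq_Phi n g g' : (forall c, size c = n -> g c = g' c) -> Phi n g = Phi n g'.
Proof. by move=> e; apply: eq_bigr => c _; rewrite e // size_tuple. Qed.

Lemma descPhi r m g : (desc r)%:P * Phi m g =
  Phi (r + m) (fun c => (all negb (take r.-1 c))%:R * g (drop r c)).
Proof.
rewrite /Phi mulr_sumr.
transitivity (\sum_(c : m.-tuple bool) \sum_(c' : (r + m).-tuple bool)
   ((all negb (take r.-1 c') && (drop r c' == c))%:R * (g c * (Wser c')%:P))).
  apply: eq_bigr => c _; rewrite mulrCA -polyCM.
  have := descM r c; rewrite size_tuple => ->.
  rewrite rmorph_sum /= mulr_sumr big_mkcond /=; apply: eq_bigr => c' _.
  by case: ifP => _; rewrite ?mul1r ?mul0r.
rewrite exchange_big /=; apply: eq_bigr => c' _.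
have sd : size (drop r c') == m by rewrite size_drop size_tuple addKn.
rewrite (bigD1 (Tuple sd)) //= eqxx andbT big1 ?addr0 ?mulrA // => c ne.
rewrite (negbTE (_ : drop r c' != c)) ?andbF ?mul0r //.
by apply: contra ne => /eqP e; apply/eqP/val_inj; rewrite /= e.
Qed.

Lemma Phi_sum n m (F : 'I_m -> seq bool -> {poly xyser}) :
  \sum_(i < m) Phi n (F i) = Phi n (fun c => \sum_(i < m) F i c).
Proof.
rewrite exchange_big /=; apply: eq_bigr => c _; by rewrite mulr_suml.
Qed.

Lemma PhiD n g g' : Phi n g + Phi n g' = Phi n (fun c => g c + g' c).
Proof. by rewrite -big_split /=; apply: eq_bigr => c _; rewrite mulrDl. Qed.

Lemma PhiZ n a g : a * Phi n g = Phi n (fun c => a * g c).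
Proof. by rewrite mulr_sumr; apply: eq_bigr => c _; rewrite mulrA. Qed.

End AscentPatterns.

(** * The weight of an ascent pattern *)

Section Weights.
Implicit Types (c : seq bool) (b : bool).

Definition stable c : bool := sorted (fun a b => ~~ (a && b)) c.

Lemma Stab_cardE n (A : {set 'I_n}) c b k : size c = n ->
    (forall i : 'I_n, (i \in A) = nth false c i) ->
  Stab_card b k A = [&& stable c, count id c == k & last false c == b].
Proof.
move=> sc hA; rewrite /Stab_card; congr [&& _, _ & _].
- apply/forall_inP/(sortedP false) => [h i|h i iA].
    rewrite sc => i1; apply/negP => /andP[ci cj].
    have iA : Ordinal (ltnW i1) \in A by rewrite hA.
    have jA : Ordinal i1 \in A by rewrite hA.
    by have /forall_inP/(_ _ jA) := h _ iA; rewrite eqxx.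
  apply/forall_inP => j jA; apply/eqP => e.
  have := h i; rewrite sc -e ltn_ord => /(_ isT).
  by rewrite -!hA iA jA.
- congr (_ == k); rewrite -sum1_card -sum1_count (big_nth false) sc big_mkord.
  by apply: eq_bigl => i; rewrite hA.
- congr (_ == b); rewrite -nth_last sc.
  apply/exists_inP/idP => [[i iA /eqP <-]|h]; first by rewrite -hA.
  case: n A sc hA h => [|n] A sc hA h; first by case: (c) sc h.
  by exists ord_max; rewrite ?hA.
Qed.

Lemma stable_cons a c : stable (a :: c) = ~~ (a && head false c) && stable c.
Proof. by case: c => //=; rewrite ?andbF. Qed.

(** In a stable pattern every ascent except a final one is followed by a descent. The [head] term is
    the slack needed to prepend an ascent in the induction; its default [true] suits the empty
    pattern. *)
Lemma stable_count c : stable c ->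
  (2 * count id c + ~~ head true c <= size c + last false c)%N.
Proof.
elim: c => // a c IH; rewrite stable_cons => /andP[h /IH].
by case: a h => /=; case: c {IH} => [|[] c] //= _; lia.
Qed.

Lemma count_stable_last c : last false c -> (0 < count id c)%N.
Proof.
case/lastP: c => // c a; rewrite last_rcons => ->.
by rewrite -cats1 count_cat /= addn1.
Qed.

(* The weights of [Asc_B] in the two generating functions, [b] telling whether
   [n] is an ascent; [wtail b c] is the weight of [c] after an ascent, up to
   the factor [t] of that ascent. *)
Definition weight b c : {poly xyser} :=
  if stable c && (last false c == b) then
    'X ^+ count id c * (1 + 'X) ^+ (size c + b - 2 * count id c)
  else 0.

Definition wtail b c : {poly xyser} :=
  match c with
  | [::] => b%:R
  | false :: c' => weight b c'
  | true :: _ => 0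
  end.

Lemma weight_false b c : weight b (false :: c) = (1 + 'X) * weight b c.
Proof.
rewrite /weight stable_cons /=.
case: (boolP (stable c)) => [sc|]; last by rewrite mulr0.
case: eqP => [e|]; last by rewrite mulr0.
(* Natural subtraction truncates, so the exponent grows by one only thanks to the bound of
   [stable_count]. *)
rewrite mulrCA -exprS; congr (_ * _ ^+ _).
by have := stable_count sc; rewrite e; lia.
Qed.

Lemma weight_true b c : weight b (true :: c) = 'X * wtail b c.
Proof.
case: c => [|[] c]; rewrite /weight !stable_cons /= ?mulr0 //.
  by case: b => /=; rewrite ?mulr0 // expr1 !mulr1.
rewrite /weight add0n.
case: (boolP (stable c)) => [sc|]; last by rewrite mulr0.
case: eqP => [e|]; last by rewrite mulr0.
rewrite mulrA -exprS; congr (_ * _ ^+ _); lia.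
Qed.

(** Before a leading descent, the term [i = 0] contributes [kap] and the others are multiplied by
    [s], in total [kap + s]. Before a leading ascent only [i = 1] survives, with coefficient
    [kap * s]. The last term adjusts the value at the empty pattern from [kap * b%:R] to
    [(~~ b)%:R]. *)
Lemma weight_rec (kap s : {poly xyser}) b c : kap + s = 1 + 'X -> kap * s = 'X ->
  weight b c =
    kap * \sum_(i < (size c).+1)
            s ^+ i * ((all negb (take i.-1 c))%:R * wtail b (drop i c))
    + ((~~ b)%:R - kap * b%:R) * (s ^+ size c * (all negb c)%:R).
Proof.
move=> e1 e2; rewrite big_ord_recl /= take0 drop0 expr0 !mul1r mulrDr -addrA.
(* The terms with [i >= 1] together with the last term. *)
pose S c := kap * (\sum_(i < size c)
    s ^+ i.+1 * ((all negb (take i c))%:R * wtail b (drop i.+1 c)))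
    + ((~~ b)%:R - kap * b%:R) * (s ^+ size c * (all negb c)%:R).
rewrite -/(S c).
have Scons a c' : S (a :: c') = kap * s * wtail b c' + (~~ a)%:R * (s * S c').
  rewrite /S /= big_ord_recl /= drop0 expr1 mul1r.
  rewrite mulrDr -!addrA mulrA; congr (_ + _).
  rewrite !mulrDr; congr (_ + _).
    rewrite !mulr_sumr; apply: eq_bigr => i _ /=.
    by rewrite -mulnb natrM exprS; ring.
  by rewrite -mulnb natrM exprS; ring.
elim: c => [|a c IH].
  have -> : weight b [::] = (~~ b)%:R by rewrite /weight; case: (b); rewrite //= !expr0 mulr1.
  by rewrite /S big_ord0 /= expr0; ring.
rewrite Scons; case: a => /=.
  by rewrite weight_true e2 mulr0 mul0r addr0 add0r.
by rewrite weight_false -e1 mulrDl; congr (_ + _); rewrite IH; ring.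
Qed.

End Weights.

(** * Elementary symmetric functions as word series *)

Section Elementary.

Lemma word_class_partition n b k :
  gser (word_class n b k) id =
  \sum_(c : n.-tuple bool | [&& stable c, count id c == k & last false c == b])
     Wser c.
Proof.
rewrite -(wser_partition _
  (fun c => [&& stable c, count id c == k & last false c == b])).
apply: eq_gser => //; apply/seteqP; split=> u [su].
  by rewrite (@Stab_cardE _ _ (asc_bits u)) ?size_asc_bits // => i; exact: mem_word_asc.
move=> h; split=> //; rewrite (@Stab_cardE _ _ (asc_bits u)) ?size_asc_bits //.
by move=> i; exact: mem_word_asc.
Qed.

(** The range of [k] omits no pattern of nonzero weight: [stable_count] gives the upper bound, and a
    final ascent makes the count positive when [b] holds. *)
Lemma sum_word_class n (b : bool) lo : (lo <= b)%N ->
  \sum_(lo <= k < (n + b)./2.+1)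
     (gser (word_class n b k) id)%:P * 'X ^+ k * (1 + 'X) ^+ (n + b - 2 * k) =
  Phi n (weight b).
Proof.
move=> hlo; under eq_bigr do rewrite word_class_partition rmorph_sum /= -mulrA mulr_suml.
transitivity (\sum_(c : n.-tuple bool) \sum_(lo <= k < (n + b)./2.+1 | k == count id c)
   (stable c && (last false c == b))%:R * ('X ^+ k * (1 + 'X) ^+ (n + b - 2 * k)
     * (Wser c)%:P : {poly xyser})).
  under [RHS]eq_bigr do rewrite big_mkcond /=.
  rewrite [RHS]exchange_big /=; apply: eq_bigr => k _.
  rewrite big_mkcond; apply: eq_bigr => c _.
  rewrite [k == _]eq_sym; case: (stable c); case: (count id c == k); case: (last _ c == b);
    by rewrite /= ?mul0r ?mul1r // mulrC.
rewrite /Phi; apply: eq_bigr => c _; rewrite big_nat1_eq /weight size_tuple.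
case: ifP => [_|]; first by case: ifP; rewrite ?mul1r ?mul0r.
case: ifP => [/andP[sc /eqP lc]|]; last by rewrite mul0r.
have := stable_count sc; rewrite size_tuple lc => h1 /negbT.
have h2 : b -> (0 < count id c)%N by rewrite -lc; exact: count_stable_last.
move=> /negP[]; apply/andP; split; last by lia.
by move: hlo h2; clear; case: b => /= [hlo /(_ isT)|hlo _]; lia.
Qed.

Definition decr r : set (seq nat) := [set s | size s = r /\ sorted gtn s].

Lemma elemsymE (g : nat -> letter) r :
  elemsym (fun i => mser_var (g i)) r = gser (decr r) (map g).
Proof.
transitivity (gser [set A : {fset nat} | #|` A| = r] (fun A => map g A) : xyser).
  apply/funext => m; apply: eq_fsbigr => A _.
  by rewrite -prod_mser_var big_map.
apply: (eq_gser_bij (h := fun A : {fset nat} => sort geq A)); last first.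
  by move=> A _; apply/perm_wt/perm_map; rewrite perm_sort.
have geq_total : total geq by move=> a b; exact: leq_total.
split.
- move=> A /= cA; split; first by rewrite size_sort.
  by rewrite gtn_sorted_uniq_geq sort_uniq fset_uniq sort_sorted.
- move=> A B _ _ e; apply/fsetP => i.
  by rewrite -[i \in A](mem_sort geq) e mem_sort.
- move=> s /= [ss srt]; have us : uniq s.
    by move: srt; rewrite gtn_sorted_uniq_geq => /andP[].
  have ps : perm_eq [fset x in s]%fset s.
    by apply: uniq_perm => // x; rewrite inE.
  exists [fset x in s]%fset; first by rewrite /= -ss; exact: perm_size.
  apply: (sorted_eq (leT := geq)).
  + by move=> a b c /= h1 h2; exact: leq_trans h2 h1.
  + by move=> a b /=; rewrite andbC => /anti_leq.
  + exact: sort_sorted.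
  + by move: srt; rewrite gtn_sorted_uniq_geq => /andP[].
  + by rewrite perm_sort.
Qed.

Lemma finfib_decr (g : nat -> letter) r : injective g -> finfib (decr r) (map g).
Proof. by move=> gi; apply: finfib_inj => s s' _ _; exact: inj_map. Qed.

(** The zero last bit makes the last letter positive. Positivity spreads to the left, as a negative
    letter before a positive one is an ascent; what remains is a strictly decreasing word in the [x]
    variables. *)
Lemma Phi_elemsym n :
  Phi n (fun c => (all negb c)%:R) = (elemsym xvar n)%:P.
Proof.
have -> : elemsym xvar n = gser [set u | size u = n /\ all negb (asc_bits u)] id.
  have e : elemsym xvar n = _ := elemsymE inl n.
  rewrite e; apply: (eq_gser_bij (h := map inl)) => //.
  have E (s : seq nat) : all negb (asc_bits (map inl s)) = sorted gtn s.
    elim: s => [|a [|b s] IH] //.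
    transitivity (~~ ascent (inl a) (inl b) && all negb (asc_bits (map inl (b :: s)))).
      by [].
    by rewrite IH /= /ascent /= -ltnNge.
  split.
  - by move=> s [ss hs]; split; rewrite ?size_map // E.
  - by move=> s s' _ _; apply: inj_map; exact: inl_inj.
  - move=> u [su hu]; have eu : u = map inl (map lval u).
      have : all lsign u.
        elim: u hu {su} => [|a u IH] //= /andP[h /[dup] hu /IH ->].
        case: u h hu {IH} => [|b u]; first by rewrite negbK => ->.
        move=> + hu; have : lsign b.
          elim: u b hu => [|c u IH] b /= /andP[]; first by rewrite negbK.
          by move=> + /IH; rewrite /ascent => /norP[]; case: (lsign b)=> //;
            case: (lsign c).
        by rewrite /ascent => ->; case: (lsign a).
      by elim: u {su hu} => //= -[a|//] u IH /IH {1}->.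
    exists (map lval u) => //; split; first by rewrite size_map.
    by rewrite -E -eu.
rewrite -/(Phi _ _) (wser_partition n (all negb)) rmorph_sum /= [RHS]big_mkcond /=.
by apply: eq_bigr => c _; case: ifP => _; rewrite ?mul1r ?mul0r.
Qed.

(** Without ascents, no negative letter precedes a positive one, and each sign class decreases
    strictly: the word is a subset of [x] variables followed by a subset of [y] variables. *)
Lemma desc_elemsym r :
  desc r = \sum_(i < r.+1) elemsym xvar i * elemsym yvar (r - i).
Proof.
pose D (a b : letter) := ~~ ascent a b.
(* Transitivity turns the condition on neighbours into one on all pairs, which splits along a
   concatenation. *)
have Dtr : transitive D.
  move=> b a c; rewrite /D /ascent.
  by case: (lsign a); case: (lsign b); case: (lsign c) => //=; lia.
have E u : all negb (take (size u).-1 (asc_bits u)) = sorted D u.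
  by elim: u => [|a [|b u] IH] //; move: IH; rewrite /= => ->.
pose X := [set p : seq nat * seq nat |
   [/\ sorted gtn p.1, sorted gtn p.2 & (size p.1 + size p.2 = r)%N]].
pose f (p : seq nat * seq nat) : seq letter := map inl p.1 ++ map inr p.2.
have fE p : sorted D (f p) = sorted gtn p.1 && sorted gtn p.2.
  have gtr : transitive gtn by move=> a b c /= h1 h2; exact: ltn_trans h2 h1.
  rewrite !sorted_pairwise // pairwise_cat !pairwise_map.
  rewrite (_ : allrel _ _ _); last first.
    by apply/allrelP => _ _ /mapP[a _ ->] /mapP[b _ ->].
  by rewrite andTb; congr (_ && _); apply: eq_pairwise => a b; rewrite /D /ascent /= -ltnNge.
have fsurj u : sorted D u -> exists p, f p = u.
  rewrite sorted_pairwise //; elim: u => [|a u IH] /=; first by exists ([::], [::]).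
  move=> /andP[/allP h /IH [[s1 s2] e]]; case: a h => x h.
    by exists (x :: s1, s2); rewrite -e.
  exists ([::], x :: s2); rewrite -e /f /=; case: s1 e => //= y s1 e.
  by have := h (inl y); rewrite -e inE eqxx => /(_ isT).
have finj : injective f.
  move=> [s1 s2] [s3 s4]; rewrite /f /= => e.
  have := congr1 (fun u => [seq lval a | a <- u & lsign a]) e.
  have := congr1 (fun u => [seq lval a | a <- u & ~~ lsign a]) e.
  rewrite /= !filter_cat !filter_map /preim /= !filter_pred0 !filter_predT.
  by rewrite /= ?cats0 -!map_comp !map_id => -> ->.
transitivity (gser X f : xyser).
  symmetry; apply: (eq_gser_bij (h := f)) => //; split.
  - move=> p [h1 h2 h3] /=; have sf : size (f p) = r by rewrite size_cat !size_map.
    by split=> //; rewrite -sf E fE h1.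
  - by move=> p q _ _; exact: finj.
  - move=> u [su]; rewrite -su E => /[dup] h /fsurj [p ep]; exists p => //.
    move: h; rewrite -ep fE => /andP[h1 h2]; split=> //.
    by rewrite -su -ep size_cat !size_map.
rewrite (@gser_partition _ _ _ _ _ _ (fun p => size p.1) (iota 0 r.+1)); first last.
- by move=> p [_ _ <-]; rewrite mem_iota /= add0n ltnS leq_addr.
- exact: iota_uniq.
- by apply: finfib_inj => p q _ _; exact: finj.
rewrite -[iota 0 _]/(index_iota 0 r.+1) big_mkord; apply: eq_bigr => i _.
have e1 : elemsym xvar i = _ := elemsymE inl i.
have e2 : elemsym yvar (r - i) = _ := elemsymE inr (r - i).
transitivity (gser (decr i) (map inl) * gser (decr (r - i)) (map inr) : xyser);
  last exact: (esym (congr2 *%R e1 e2)).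
rewrite gserM; try by apply: finfib_decr => ? ? [].
apply: eq_gser => //; apply/seteqP; split=> -[s1 s2] /=.
  by move=> [[h1 h2 h3] h4]; split; split=> //=; rewrite /= in h3; lia.
move=> [[h1 h2] [h3 h4]]; split=> //; split=> //=.
by rewrite h1 h3 subnKC // -ltnS.
Qed.

End Elementary.

(** * Power series in [z] *)

Section ZSeries.

Definition zmon n : {cmonom unit} := wt (nseq n tt).

Lemma zmonE n : zmon n tt = n.
Proof.
rewrite /zmon; elim: n => [|n IH]; first by rewrite wt_nil cm1.
by rewrite wt_cons cmM IH cmUU.
Qed.

Lemma cmonom_unitP (m : {cmonom unit}) : m = zmon (m tt).
Proof. by apply/eqP/cmP => -[]; rewrite zmonE. Qed.

Lemma zmon_inj : injective zmon.
Proof. by move=> i j e; rewrite -(zmonE i) e zmonE. Qed.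

Lemma zmonM i j : mmul (zmon i) (zmon j) = zmon (i + j).
Proof. by rewrite /zmon nseqD wt_cat. Qed.

Context {R : comNzRingType}.
Implicit Types f g : mseries unit R.

Lemma zser_eqP f g : (forall n, f (zmon n) = g (zmon n)) -> f = g.
Proof. by move=> e; apply/funext => m; rewrite (cmonom_unitP m). Qed.

Lemma coefMz f g n :
  (f * g) (zmon n) = \sum_(i < n.+1) f (zmon i) * g (zmon (n - i)).
Proof.
rewrite [LHS]/(mser_mul f g (zmon n)) /mser_mul.
rewrite (fsbig_ord _ n.+1 (fun i => f (zmon i) * g (zmon (n - i)))).
have bij : set_bij `I_n.+1 (factors (zmon n)) (fun i => (zmon i, zmon (n - i))).
  split.
  - by move=> i /=; rewrite ltnS /factors /= => h; rewrite zmonM subnKC.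
  - by move=> i j _ _ [] /zmon_inj.
  - move=> [a b]; rewrite /factors /= (cmonom_unitP a) (cmonom_unitP b) zmonM.
    move=> /zmon_inj e; exists (a tt) => /=; first by rewrite ltnS -e leq_addr.
    by rewrite -e addKn.
by rewrite (reindex_fsbig _ _ _ (fun p => f p.1 * g p.2) bij).
Qed.

Lemma exp_zvar n : (mser_var tt : mseries unit R) ^+ n = mon (zmon n).
Proof.
elim: n => [|n IH]; first by rewrite expr0 /zmon wt_nil.
by rewrite exprS IH /zmon /= wt_cons -monM.
Qed.

Lemma coef_formal_sum (A : set nat) (a : nat -> R) n :
  (formal_sum A (fun k => a k *: (mser_var tt : mseries unit R) ^+ k)) (zmon n) =
  if n \in A then a n else 0.
Proof.
rewrite /formal_sum.
have E k : (a k *: (mser_var tt : mseries unit R) ^+ k) (zmon n) =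
    if k == n then a n else 0.
  rewrite exp_zvar; transitivity (a k * (zmon n == zmon k)%:R); first by [].
  rewrite (inj_eq zmon_inj) eq_sym.
  by case: (k =P n) => [->|_]; rewrite ?mulr1 ?mulr0.
case: (boolP (n \in A)) => [/set_mem nA|nA].
  rewrite (fsbigE [:: n]) //=.
  - by rewrite big_cons big_nil mem_set // E eqxx addr0.
  - by move=> k /=; rewrite inE => /eqP ->.
  - by move=> k _; rewrite inE E => /negbTE ->.
rewrite fsbig1 // => k kA; rewrite E; case: eqP => // e.
by move: nA; rewrite -e mem_set.
Qed.

Lemma zscaleX (s : R) f n : (s *: f) ^+ n = s ^+ n *: f ^+ n.
Proof.
elim: n => [|n IH]; first by rewrite !expr0 scale1r.
rewrite !exprS IH -scalerAl mulrC -scalerAl scalerA; congr (_ *: _).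
exact: mulrC.
Qed.

(** By strong induction, the equation at [z^n] reduces to the constant coefficient times the two
    [n]-th coefficients. *)
Lemma lreg_zser f : GRing.lreg (f (zmon 0)) -> GRing.lreg f.
Proof.
move=> f0 g h e; apply: zser_eqP => n.
elim/ltn_ind: n => n IH; apply: f0.
have := congr1 (fun q : mseries unit R => q (zmon n)) e.
rewrite /= !coefMz !big_ord_recl /= subn0.
rewrite [X in _ + X = _ -> _](eq_bigr
  (fun i : 'I_n => f (zmon (bump 0 i)) * h (zmon (n - bump 0 i)))).
  exact: addIr.
by move=> i _; rewrite IH //; have := ltn_ord i; rewrite /bump; lia.
Qed.

End ZSeries.

(** * Linear equations for the weighted word series *)

Section GeneratingFunctions.
Variable b : bool.

Definition Tser : zser := formal_sum [set: nat] (fun n => Phi n (weight b) *: zvar ^+ n).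

Definition User : zser := formal_sum [set: nat] (fun n => Phi n (wtail b) *: zvar ^+ n).

Lemma coef_Egen (g : nat -> letter) (s : tpoly) n :
  (Egen (fun i => mser_var (g i)) (s *: zvar)) (zmon n) =
  (elemsym (fun i => mser_var (g i)) n)%:P * s ^+ n.
Proof.
transitivity ((formal_sum [set: nat] (fun k =>
   ((elemsym (fun i => mser_var (g i)) k)%:P * s ^+ k) *: zvar ^+ k) : zser) (zmon n)).
  by apply: eq_fsbigr => k _; rewrite zscaleX scalerA.
by rewrite coef_formal_sum mem_set.
Qed.

Lemma coef_Ex (s : tpoly) n :
  Egen xvar (s *: zvar) (zmon n) = (elemsym xvar n)%:P * s ^+ n.
Proof. exact: (coef_Egen inl s n). Qed.

Lemma coef_Ey (s : tpoly) n :
  Egen yvar (s *: zvar) (zmon n) = (elemsym yvar n)%:P * s ^+ n.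
Proof. exact: (coef_Egen inr s n). Qed.

Lemma coef_ExEy (s : tpoly) n :
  (Egen xvar (s *: zvar) * Egen yvar (s *: zvar)) (zmon n) =
  (desc n)%:P * s ^+ n.
Proof.
rewrite coefMz desc_elemsym rmorph_sum /= mulr_suml; apply: eq_bigr => i _.
transitivity ((elemsym xvar i)%:P * s ^+ i *
              ((elemsym yvar (n - i))%:P * s ^+ (n - i)) : tpoly).
  exact: (congr2 *%R (coef_Ex s i) (coef_Ey s (n - i))).
have hi : (i + (n - i) = n)%N by rewrite subnKC // -ltnS.
rewrite mulrACA -exprD hi.
by rewrite -polyCM.
Qed.

(** This is [weight_rec] coefficient by coefficient: prefixes without ascent come from [coef_ExEy]
    and [descPhi], the all-zero pattern from [Phi_elemsym]. *)
Lemma Tser_rec (kap s : tpoly) : kap + s = 1 + 'X -> kap * s = 'X ->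
  Tser = kap *: (Egen xvar (s *: zvar) * Egen yvar (s *: zvar) * User)
       + ((~~ b)%:R - kap * b%:R) *: Egen xvar (s *: zvar).
Proof.
move=> e1 e2; apply: zser_eqP => n.
set F := Egen xvar _ * _; set c := (_ - _).
transitivity (kap * (F * User) (zmon n) + c * Egen xvar (s *: zvar) (zmon n)); last by [].
rewrite coef_Ex {1}/Tser coef_formal_sum mem_set // -Phi_elemsym.
rewrite (coefMz F).
have E (i : 'I_n.+1) : F (zmon i) * User (zmon (n - i)) =
    Phi n (fun c => s ^+ i * ((all negb (take i.-1 c))%:R * wtail b (drop i c))).
  rewrite /F coef_ExEy /User coef_formal_sum mem_set // mulrAC descPhi.
  have -> : (i + (n - i) = n)%N by rewrite subnKC // -ltnS.
  by rewrite mulrC PhiZ.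
rewrite (eq_bigr _ (fun i _ => E i)) Phi_sum [_ * s ^+ n]mulrC !PhiZ PhiD.
by apply: eq_Phi => d sd; rewrite (weight_rec b d e1 e2) sd.
Qed.

End GeneratingFunctions.

Lemma gamma_plus_words n k : gamma_plus n k = gser (word_class n false k) id.
Proof.
case: n => [|n]; last exact: gamma_words.
have E : Stab_card false k (word_asc 0 [::]) = (k == 0%N).
  rewrite (@Stab_cardE 0 _ [::] false k erefl); last by case.
  by rewrite /= andbT eq_sym.
rewrite /gamma_plus; case: (k =P 0%N) E => [_|_] E.
  rewrite (@eq_gser _ _ _ _ [set [::]] _ id) ?gser_set1 ?wt_nil //.
  by apply/seteqP; split=> [u [/size0nil -> _]|u ->] //; split.
apply/funext => m; rewrite /gser /formal_sum fsbig1 // => u [/size0nil ->].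
by rewrite E.
Qed.

(** * Elimination of the tail series *)

Definition denom : zser :=
  Egen xvar (tvar *: zvar) * Egen yvar (tvar *: zvar)
  - tvar *: (Egen xvar zvar * Egen yvar zvar).

Lemma desc0 : desc 0 = 1.
Proof.
rewrite /desc -mon1 -wt_nil -(gser_set1 [::] id).
apply: eq_gser => //; apply/seteqP; split=> u /=; first by case=> /size0nil.
by move=> ->.
Qed.

Lemma coef_ExEy1 n : (Egen xvar zvar * Egen yvar zvar) (zmon n) = (desc n)%:P.
Proof. by have := coef_ExEy 1 n; rewrite expr1n mulr1 scale1r. Qed.

(** The constant coefficient is [1 - t], the opposite of a monic polynomial, hence regular over any
    coefficient ring. *)
Lemma lreg_denom : GRing.lreg denom.
Proof.
apply: lreg_zser.
have -> : denom (zmon 0) = - ('X - 1%:P).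
  transitivity ((desc 0)%:P * tvar ^+ 0 - tvar * (desc 0)%:P : tpoly).
    exact: (congr2 (fun a b : tpoly => a - tvar * b) (coef_ExEy tvar 0) (coef_ExEy1 0)).
  by rewrite desc0 expr0 !mulr1 opprB.
exact/lregN/monic_lreg/monicXsubC.
Qed.

Lemma coef_Tser b n : Tser b (zmon n) = Phi n (weight b).
Proof. by rewrite /Tser coef_formal_sum mem_set. Qed.

(** Turns scalings into products by an opaque [c a], so that [ring] can finish. *)
Lemma scale_as_mul (R : comNzRingType) :
  exists c : R -> mseries unit R, forall a f, a *: f = c a * f.
Proof. by exists (fun a => a%:A) => a f; rewrite mulr_algl. Qed.

(** The first equation is substituted in the term [ext * eyt * T], the second in
    [t *: (ex * ey) * T]; both then contain the same multiple of [U], which cancels. *)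
Lemma eliminate_tail (R : comNzRingType) (t p q : R)
    (ex ey ext eyt U T : mseries unit R) :
    T = t *: (ex * ey * U) + p *: ex -> T = 1 *: (ext * eyt * U) + q *: ext ->
  (ext * eyt - t *: (ex * ey)) * T =
  ext * (p *: (eyt * ex) - (t * q) *: (ex * ey)).
Proof.
rewrite scale1r => e1 e2; rewrite mulrBl {1}e1 e2.
(* The opaque [c] is not known to be multiplicative, so the scalar is split beforehand. *)
rewrite -[(t * q) *: _]scalerA.
by have [c cE] := scale_as_mul R; rewrite !cE; ring.
Qed.

(* [numerator_plus] and [numerator_minus] are stated for the right-hand side of
   [denom_Tser] at [b = false] and [b = true]. *)
Lemma numerator_plus (R : comNzRingType) (t : R) (ex ey ext eyt : mseries unit R) :
  ext * (((~~ false)%:R - t * false%:R) *: (eyt * ex)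
         - (t * ((~~ false)%:R - 1 * false%:R)) *: (ex * ey)) =
  ex * ext * (eyt - t *: ey).
Proof.
rewrite /= !mulr0 !subr0 mulr1 scale1r.
by have [c cE] := scale_as_mul R; rewrite !cE; ring.
Qed.

Lemma numerator_minus (R : comNzRingType) (t : R) (ex ey ext eyt : mseries unit R) :
  ext * (((~~ true)%:R - t * true%:R) *: (eyt * ex)
         - (t * ((~~ true)%:R - 1 * true%:R)) *: (ex * ey)) =
  t *: (ex * ext * (ey - eyt)).
Proof.
rewrite /= !mulr1 !sub0r mulrN1 !scaleNr.
by have [c cE] := scale_as_mul R; rewrite !cE; ring.
Qed.

Lemma denom_Tser b :
  denom * Tser b =
    Egen xvar (tvar *: zvar) *
     (((~~ b)%:R - tvar * b%:R) *: (Egen yvar (tvar *: zvar) * Egen xvar zvar)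
     - (tvar * ((~~ b)%:R - 1 * b%:R)) *: (Egen xvar zvar * Egen yvar zvar)).
Proof.
have e2 := @Tser_rec b tvar 1 (addrC _ _) (mulr1 _); rewrite scale1r in e2.
exact: (eliminate_tail e2 (@Tser_rec b 1 tvar erefl (mul1r _))).
Qed.

Theorem corollary4p7 :
  let x := xvar in
  let y := yvar in
  let t := tvar in
  let z := zvar in
  let E := Egen in
  let den := E x (t *: z) * E y (t *: z) - t *: (E x z * E y z) in
  [/\ is_quotient
        (E x z * E x (t *: z) * (E y (t *: z) - t *: E y z)) den
        (formal_sum [set: nat] (fun n =>
           (\sum_(0 <= k < n./2.+1)
              (gamma_plus n k)%:P * t ^+ k * (1 + t) ^+ (n - 2 * k))
           *: z ^+ n)),
      is_quotient
        (t *: (E x z * E x (t *: z) * (E y z - E y (t *: z)))) den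
        (formal_sum [set n : nat | (1 <= n)%N] (fun n =>
           (\sum_(1 <= k < n.+1./2.+1)
              (gamma_minus n k)%:P * t ^+ k * (1 + t) ^+ (n.+1 - 2 * k))
           *: z ^+ n)),
      (forall n k : nat, (1 <= n)%N ->
         gamma_plus n k =
           \sum_(w in hyperoct n | Stab_card false k (AscB_perm w^-1%g))
              F_sDes w) &
      (forall n k : nat, (1 <= n)%N ->
         gamma_minus n k =
           \sum_(w in hyperoct n | Stab_card true k (AscB_perm w^-1%g))
              F_sDes w)].
Proof.
move=> x y t z E D; split; first last.
- by move=> n k _; rewrite sum_F_sDes -gamma_words.
- by move=> n k _; rewrite sum_F_sDes -gamma_plus_words.
- split; first exact: lreg_denom.
  transitivity (denom * Tser true : zser); last first.
    exact: (etrans (denom_Tser true) (numerator_minus _ _ _ _ _)).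
  congr (_ * _); apply: zser_eqP => n; rewrite coef_Tser coef_formal_sum.
  case: n => [|n].
    (* The empty pattern has no final ascent, so [Tser true] has no constant term, in accordance
       with a sum over [n >= 1]. *)
    rewrite memNset // /Phi big1 // => c _.
    by rewrite (tuple0 c) /weight /= mul0r.
  rewrite mem_set // -(sum_word_class _ (leqnn true)) addn1.
  by apply: eq_bigr => k _; rewrite /gamma_minus gamma_words.
- split; first exact: lreg_denom.
  transitivity (denom * Tser false : zser); last first.
    exact: (etrans (denom_Tser false) (numerator_plus _ _ _ _ _)).
  congr (_ * _); apply: zser_eqP => n; rewrite coef_Tser coef_formal_sum mem_set //.
  rewrite -(sum_word_class _ (leqnn false)) addn0.
  by apply: eq_bigr => k _; rewrite gamma_plus_words.
Qed.
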